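(* Let $\Lambda$ be a commutative discrete valuation ring. Given partitions $\alpha,\beta,\gamma$, there exists a short exact sequence of $\Lambda$-modules $$0\longrightarrow A\longrightarrow B\longrightarrow C\longrightarrow 0$$ where $A$, $B$, $C$ have partition type $\alpha$, $\beta$, $\gamma$, respectively, if and only if there exists a socle tableau of shape $(\alpha,\beta,\gamma)$.
   Context: Let $p$ be a generator of the maximal ideal of $\Lambda$. All $\Lambda$-modules have finite length. For a partition $\lambda=(\lambda_1\ge\dots\ge\lambda_n\geq 1)$ put $N_\lambda=\Lambda/(p^{\lambda_1})\oplus\cdots\oplus\Lambda/(p^{\lambda_n})$; a $\Lambda$-module $M$ has partition type $\lambda$ if $M\cong N_\lambda$ (every finite length module has a unique type). The Young diagram of a partition $\lambda$ is drawn with columns of lengths $\lambda_1,\lambda_2,\dots$ from left to right, aligned at the top; rows are numbered from top to bottom, columns from left to right. $\lambda'$ denotes the transpose, so $\lambda'_i=\#\{j:\lambda_j\ge i\}$ is the length of the $i$-th row. If $\gamma\le\beta$ (i.e. $\gamma_i\le\beta_i$ for all $i$), the skew diagram $\beta\setminus\gamma$ consists of the boxes in row $r$ and column $j$ with $\gamma_j<r\le\beta_j$. A socle tableau of shape $(\alpha,\beta,\gamma)$ (which requires $\gamma\le\beta$ and $|\alpha|+|\gamma|=|\beta|$, otherwise there are none) is a filling of $\beta\setminus\gamma$ with $\alpha'_1$ entries $1$, $\alpha'_2$ entries $2$, etc., such that: (ST-1) in each row, the entries are weakly decreasing (from left to right); (ST-2) in each column, the entries are strictly decreasing (from top to bottom);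 (ST-3) for each vertical line, and each natural number $\ell\ge1$, there are at most as many entries $\ell+1$ on the left hand side of the line as there are entries $\ell$. *)

(* Defs.v *)
From HB Require Import structures.
From mathcomp Require Import all_boot all_order all_algebra.
From mathcomp Require Import generic_quotient ring_quotient.
From mathcomp Require Import boolp.

Set Implicit Arguments.
Unset Strict Implicit.
Unset Printing Implicit Defensive.

Import GRing.Theory.
Local Open Scope ring_scope.
Local Open Scope quotient_scope.

(** * Discrete valuation rings *)

Definition principal_ideal (R : comNzRingType) (a : R) : {pred R} :=
  fun x => `[< exists r, x = r * a >].

(* [idealr_closed] already requires the ideal to be proper.  Quantifying over
   [{pred R}] covers all ideals, since [asbool] makes every subset boolean. *)
Definition maximal_ideal (R : comNzRingType) (M : {pred R}) : Prop :=
  idealr_closed M /\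
  forall J : {pred R}, idealr_closed J -> {subset M <= J} -> J =i M.

(* A local principal ideal domain that is not a field; the ideal omitted by
   [idealr_closed], namely R itself, is generated by 1. *)
Definition is_dvr (R : idomainType) : Prop :=
  [/\ forall I : {pred R}, idealr_closed I ->
        exists a : R, I =i principal_ideal a,
      exists2 M : {pred R}, maximal_ideal M &
        forall M' : {pred R}, maximal_ideal M' -> M' =i M
    & exists2 x : R, x != 0 & x \isn't a GRing.unit].

(** * The cyclic module R/(a) *)

Section CyclicModule.
Variables (R : comNzRingType) (a : R).

Lemma principal_ideal_zmod_closed : zmod_closed (principal_ideal a).
Proof.
split; first by apply/asboolP; exists 0; rewrite mul0r.
move=> x y /asboolP[r ->] /asboolP[s ->].
by apply/asboolP; exists (r - s); rewrite mulrBl.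
Qed.

HB.instance Definition _ :=
  GRing.isZmodClosed.Build R (principal_ideal a) principal_ideal_zmod_closed.

Definition cyclic_module := Quotient.quot (principal_ideal a).

HB.instance Definition _ := GRing.Zmodule.on cyclic_module.

Definition cyclic_pi (x : R) : cyclic_module := \pi_cyclic_module x.

Definition cyclic_scale (r : R) (x : cyclic_module) : cyclic_module :=
  cyclic_pi (r * repr x).

Lemma cyclic_piP x y :
  reflect (exists r, x - y = r * a) (cyclic_pi x == cyclic_pi y).
Proof. by rewrite /cyclic_pi -Quotient.idealrBE; apply: asboolP. Qed.

Lemma cyclic_piD x y : cyclic_pi (x + y) = cyclic_pi x + cyclic_pi y.
Proof. exact: raddfD. Qed.

Lemma cyclic_reprK (x : cyclic_module) : cyclic_pi (repr x) = x.
Proof. exact: reprK. Qed.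

Lemma cyclic_scale_pi r x : cyclic_scale r (cyclic_pi x) = cyclic_pi (r * x).
Proof.
apply/eqP/cyclic_piP; rewrite -mulrBr.
have /eqP/cyclic_piP[s ->] := cyclic_reprK (cyclic_pi x).
by exists (r * s); rewrite mulrA.
Qed.

Lemma cyclic_scaleA r s x :
  cyclic_scale r (cyclic_scale s x) = cyclic_scale (r * s) x.
Proof. by rewrite -[x]cyclic_reprK !cyclic_scale_pi mulrA. Qed.

Lemma cyclic_scale1 : left_id 1 cyclic_scale.
Proof. by move=> x; rewrite -[x]cyclic_reprK cyclic_scale_pi mul1r. Qed.

Lemma cyclic_scaleDr : right_distributive cyclic_scale +%R.
Proof.
move=> r x y; rewrite -[x]cyclic_reprK -[y]cyclic_reprK -cyclic_piD.
by rewrite !cyclic_scale_pi mulrDr cyclic_piD.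
Qed.

Lemma cyclic_scaleDl x : {morph cyclic_scale^~ x : r s / r + s}.
Proof.
move=> r s; rewrite -[x]cyclic_reprK !cyclic_scale_pi.
by rewrite mulrDl cyclic_piD.
Qed.

HB.instance Definition _ := GRing.Zmodule_isLmodule.Build R cyclic_module
  cyclic_scaleA cyclic_scale1 cyclic_scaleDr cyclic_scaleDl.

End CyclicModule.

(** * Partitions and partition types of modules *)

Definition is_partition (lam : seq nat) : bool :=
  sorted geq lam && all (leq 1) lam.

Definition transpose_part (lam : seq nat) (i : nat) : nat := count (leq i) lam.

(* The empty direct sum is the zero module ['rV_0]. *)
Fixpoint partition_module (R : comNzRingType) (p : R) (lam : seq nat) :
    lmodType R :=
  if lam is l :: lam' then
    (cyclic_module (p ^+ l) * partition_module p lam')%type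
  else 'rV[R]_0.

Definition has_partition_type (R : comNzRingType) (p : R) (M : lmodType R)
    (lam : seq nat) : Prop :=
  exists f : {linear M -> partition_module p lam}, bijective f.

Definition short_exact (R : comNzRingType) (A B C : lmodType R)
    (f : {linear A -> B}) (g : {linear B -> C}) : Prop :=
  [/\ injective f,
      forall b : B, g b = 0 <-> exists a : A, f a = b
    & forall c : C, exists b : B, g b = c].

(** * Socle tableaux *)

(* Rows [r] and columns [j] are numbered from 0: the columns of the diagram of
   [lam] have lengths [nth 0 lam j], so that row [r] here is row [r + 1] in the
   usual numbering.  A filling is a function [T] whose value [T r j] matters
   only on boxes. *)
Definition in_skew (bet gam : seq nat) (r j : nat) : bool :=
  (nth 0 gam j <= r < nth 0 bet j)%N.

(* Number of entries [l] in the first [k] columns of the skew diagram. *)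
Definition entries_left (bet gam : seq nat) (T : nat -> nat -> nat)
    (k l : nat) : nat :=
  (\sum_(j < k) \sum_(nth 0 gam j <= r < nth 0 bet j) (T r j == l))%N.

Record socle_tableau (alp bet gam : seq nat) (T : nat -> nat -> nat) : Prop := {
  st_contained : forall j, (nth 0 gam j <= nth 0 bet j)%N;
  st_size : (sumn alp + sumn gam = sumn bet)%N;
  st_positive : forall r j, in_skew bet gam r j -> (1 <= T r j)%N;
  st_content : forall l, (1 <= l)%N ->
    entries_left bet gam T (size bet) l = transpose_part alp l;
  st_rows : forall r i j, in_skew bet gam r i -> in_skew bet gam r j ->
    (i < j)%N -> (T r j <= T r i)%N;
  st_columns : forall r s j, in_skew bet gam r j -> in_skew bet gam s j ->
    (r < s)%N -> (T s j < T r j)%N;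
  st_lattice : forall k l, (1 <= l)%N ->
    (entries_left bet gam T k l.+1 <= entries_left bet gam T k l)%N
}.

(* Main.v *)
Require Import Defs.
From HB Require Import structures.
From mathcomp Require Import all_boot all_order all_algebra.
From mathcomp Require Import boolp classical_sets zify.

(* Let A be a submodule of B with quotient C, and let h(r, i) be the number of
   cyclic summands of length > r of B / soc^i A.  Multiplication by p maps
   B / soc^(i+1) A to B / soc^i A with image p (B / soc^i A), so consecutive
   partitions differ by a horizontal strip; and it embeds
   soc^(i+2) A / soc^(i+1) A into soc^(i+1) A / soc^i A, raising p-divisibility
   in B by one, which gives the lattice condition.  Filling the strip between
   steps i and i + 1 with the entry i + 1 yields the tableau.

   Conversely, a tableau gives a chain of partitions b(0) = bet, ...,
   b(s) = gam, hence lattices p^b(i) in R^n.  The quotient maps R^n / p^b(i) ->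
   R^n / p^b(i+1), each twisted by an automorphism, compose to a surjection
   B -> C.  The automorphism moves the columns containing i + 2 but not i + 1 to
   columns further left containing i + 1 but not i + 2, a matching which the
   lattice condition provides; thanks to the twist, the i-th socle of the kernel
   A is exactly the kernel of B -> R^n / p^b(i).  As A is a sum of cyclic
   modules, the lengths of its socles identify its type. *)

Set Implicit Arguments.
Unset Strict Implicit.
Unset Printing Implicit Defensive.

Import GRing.Theory.
Local Open Scope classical_set_scope.
Local Open Scope ring_scope.

(** * The generator of the maximal ideal of a valuation ring *)

Lemma principal_idealP (R : comNzRingType) (a x : R) :
  reflect (exists r, x = r * a) (x \in principal_ideal a).
Proof. exact: asboolP. Qed.

(* Every proper ideal lies in a maximal one by Zorn's lemma, so in a local ring
   each non-unit lies in the maximal ideal. *)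
Lemma dvr_unit_or_multiple (R : idomainType) (p : R) :
  is_dvr R -> maximal_ideal (principal_ideal p) ->
  forall x, x \is a GRing.unit \/ exists y, x = y * p.
Proof.
move=> [_ [M0 _ M0u] _] pmax x; case: (boolP (x \is a GRing.unit)) => xU.
  by left.
right; pose ideal (I : set R) := [/\ I 0, ~ I 1, I x
  & forall a u v, I u -> I v -> I (a * u + v)].
pose P (I : set R) := I = set0 \/ ideal I.
have [|I [PI Imax]] := @Zorn_bigcup R P.
  move=> F FP Ftot; case: (pselect (exists2 I, F I & I !=set0)) => [|nF].
    move=> [I FI [z Iz]]; right.
    have FPI J w : F J -> J w -> ideal J.
      by move=> FJ Jw; case: (FP _ FJ) => // J0; rewrite J0 in Jw.
    have [I0 _ Ix _] := FPI _ _ FI Iz.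
    split; [by exists I|by move=> [J FJ J1]; case: (FPI _ _ FJ J1)|by exists I|].
    move=> a u v [J FJ Ju] [K FK Kv].
    have [JK|KJ] := Ftot _ _ FJ FK.
      by exists K => //; case: (FPI _ _ FK Kv) => _ _ _; apply=> //; apply: JK.
    by exists J => //; case: (FPI _ _ FJ Ju) => _ _ _; apply=> //; apply: KJ.
  left; apply/seteqP; split=> // z [I FI Iz].
  by case: nF; exists I => //; exists z.
have idI : ideal I.
  case: PI => // I0; pose J : set R := [set y | exists r, y = r * x].
  suff idJ : ideal J.
    case: (Imax J); last by right.
    by split; [rewrite I0|move=> /(_ x); rewrite I0; apply; exists 1; rewrite mul1r].
  split; first by exists 0; rewrite mul0r.
  - move=> [r r1]; move/negP: xU; apply; apply/unitrP; exists r; rewrite /=.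
    by rewrite [x * r]mulrC -r1.
  - by exists 1; rewrite mul1r.
  by move=> a u v [r ->] [s ->]; exists (a * r + s); rewrite mulrDl mulrA.
pose I' : {pred R} := fun y => `[< I y >].
have inI' y : (y \in I') = `[< I y >] by [].
have idealI' (J : set R) : J 0 -> ~ J 1 ->
    (forall a u v, J u -> J v -> J (a * u + v)) ->
    idealr_closed (fun y => `[< J y >] : bool).
  move=> J0 J1 JD; split; first exact/asboolP.
    by apply/negP => /asboolP.
  by move=> a u v /asboolP Ju /asboolP Jv; apply/asboolP; apply: JD.
case: (idI) => I0 I1 Ix ID.
have I'max : maximal_ideal I'.
  split; first exact: idealI'.
  move=> J Jid IJ y; apply/idP/idP => [yJ|]; last exact: IJ.
  rewrite inI'; apply/asboolP; apply: contrapT => nIy.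
  apply: (Imax [set z | z \in J]); first split.
  - by move=> z Iz; apply: IJ; apply/asboolP.
  - by move=> /(_ y yJ).
  case: Jid => J0 /negP J1 JD; right; split=> //=.
  by apply: IJ; apply/asboolP.
have : x \in I' by apply/asboolP.
by rewrite (M0u _ I'max) -(M0u _ pmax) => /principal_idealP [y ->]; exists y.
Qed.

Lemma dvr_generator_neq0 (R : idomainType) (p : R) :
  is_dvr R -> maximal_ideal (principal_ideal p) -> p != 0.
Proof.
move=> dvr pmax; case: (dvr) => _ _ [x x0 xU]; apply/eqP => p0.
have [xu|[y]] := dvr_unit_or_multiple dvr pmax x; first by rewrite xu in xU.
by rewrite p0 mulr0 => xe; rewrite xe eqxx in x0.
Qed.

Lemma maximal_generator_nonunit (R : idomainType) (p : R) :
  maximal_ideal (principal_ideal p) -> p \isn't a GRing.unit.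
Proof.
move=> [[_ /negP p1 _] _]; apply/negP => pU; apply: p1.
by apply/principal_idealP; exists p^-1; rewrite mulVr.
Qed.

Definition Linear_of (R : pzRingType) (U V : lmodType R) (f : U -> V)
    (f_lin : linear f) : {linear U -> V} :=
  HB.pack f (GRing.isLinear.Build R U V *:%R f f_lin).

(** * Length of submodules *)

Section Submodules.
Variable R : pzRingType.

Definition submod (M : lmodType R) (X : set M) : Prop :=
  X 0 /\ forall a x y, X x -> X y -> X (a *: x + y).

Lemma submod0 (M : lmodType R) (X : set M) : submod X -> X 0.
Proof. by case. Qed.

Lemma submodZ (M : lmodType R) (X : set M) a x : submod X -> X x -> X (a *: x).
Proof. by move=> [X0 XD] Xx; rewrite -[_ *: _]addr0; apply: XD. Qed.

Lemma submodD (M : lmodType R) (X : set M) x y :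
  submod X -> X x -> X y -> X (x + y).
Proof. by move=> [_ XD] Xx Xy; rewrite -[x]scale1r; apply: XD. Qed.

Lemma submodB (M : lmodType R) (X : set M) x y :
  submod X -> X x -> X y -> X (x - y).
Proof.
move=> sX Xx Xy; apply: submodD => //.
by rewrite -scaleN1r; apply: submodZ.
Qed.

Lemma submodT (M : lmodType R) : submod [set: M].
Proof. by []. Qed.

Lemma submod1 (M : lmodType R) : submod [set (0 : M)].
Proof. by split=> // a x y /= -> ->; rewrite scaler0 addr0. Qed.

Lemma submodI (M : lmodType R) (X Y : set M) :
  submod X -> submod Y -> submod (X `&` Y).
Proof.
move=> [X0 XD] [Y0 YD]; split=> // a x y [Xx Yx] [Xy Yy].
by split; [apply: XD|apply: YD].
Qed.

Lemma submod_ker (M N : lmodType R) (f : {linear M -> N}) :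
  submod [set x | f x = 0].
Proof.
split=> [|a x y] /=; first by rewrite linear0.
by move=> fx fy; rewrite linearP fx fy scaler0 addr0.
Qed.

Lemma submod_image (M N : lmodType R) (f : {linear M -> N}) (X : set M) :
  submod X -> submod (f @` X).
Proof.
move=> [X0 XD]; split; first by exists 0 => //; rewrite linear0.
move=> a _ _ [x Xx <-] [y Xy <-]; exists (a *: x + y); last by rewrite linearP.
exact: XD.
Qed.

Definition adjoin (M : lmodType R) (X : set M) (x : M) : set M :=
  [set y | exists c, X (y - c *: x)].

Lemma adjoin_self (M : lmodType R) (X : set M) x : submod X -> adjoin X x x.
Proof. by move=> [X0 _]; exists 1; rewrite scale1r subrr. Qed.

Lemma sub_adjoin (M : lmodType R) (X : set M) x : X `<=` adjoin X x.
Proof. by move=> y Xy; exists 0; rewrite scale0r subr0. Qed.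

Lemma submod_adjoin (M : lmodType R) (X : set M) x :
  submod X -> submod (adjoin X x).
Proof.
move=> sX; split; first by apply: sub_adjoin; apply: submod0.
move=> a y z [c Xy] [d Xz]; exists (a * c + d).
rewrite scalerDl -scalerA opprD addrACA -scalerBr.
by case: sX => _; apply.
Qed.

Lemma adjoin_sub (M : lmodType R) (X Y : set M) x :
  submod Y -> X `<=` Y -> Y x -> adjoin X x `<=` Y.
Proof.
move=> sY XY Yx y [c Xy]; rewrite -(subrK (c *: x) y).
by apply: submodD => //; [apply: XY|apply: submodZ].
Qed.

End Submodules.

(** * Composition series and the Jordan-Hoelder theorem *)

Section Length.
Variables (R : comUnitRingType) (p : R).
Hypothesis unit_or_multiple :
  forall x : R, x \is a GRing.unit \/ exists y, x = y * p.

(** Existence of a composition series of length [n]: as every scalar is a unit or a multiple of [p],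
    adjoining an [x] outside [X] with [p *: x] in [X] adds a simple layer. *)
Inductive has_length (M : lmodType R) : set M -> nat -> Prop :=
| has_length0 : has_length [set 0] 0
| has_lengthS X n x : has_length X n -> ~ X x -> X (p *: x) ->
    has_length (adjoin X x) n.+1.

Lemma has_length_submod (M : lmodType R) (X : set M) n :
  has_length X n -> submod X.
Proof.
by elim=> [|{}X {}n x _ sX _ _]; [apply: submod1|apply: submod_adjoin].
Qed.

(** Modulo [X], [y] is [c *: x]. If [c] were a multiple of [p], then [y] would lie in [X]; hence [c]
    is a unit and can be inverted. *)
Lemma adjoin_exchange (M : lmodType R) (X : set M) x y : submod X ->
  X (p *: x) -> adjoin X x y -> ~ X y -> adjoin X y x.
Proof.
move=> sX Xpx [c Xy] nXy; case: (unit_or_multiple c) => [cU|[d cE]].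
  exists c^-1; rewrite -[X in X - _]scale1r -(mulVr cU) -scalerA -scalerBr.
  apply: submodZ => //; rewrite -opprB -[- (y - _)]scaleN1r.
  exact: submodZ.
case: nXy; rewrite -(subrK (c *: x) y); apply: submodD => //.
by rewrite cE -scalerA; apply: submodZ.
Qed.

Lemma adjoin_eq (M : lmodType R) (X : set M) x y : submod X ->
  X (p *: x) -> adjoin X x y -> ~ X y -> adjoin X x = adjoin X y.
Proof.
move=> sX Xpx Xxy nXy; apply/seteqP; split; apply: adjoin_sub => //;
  try exact: submod_adjoin; try exact: sub_adjoin.
exact: adjoin_exchange Xxy _.
Qed.

Lemma adjoin_scale (M : lmodType R) (X : set M) x y : submod X ->
  X (p *: x) -> adjoin X x y -> X (p *: y).
Proof.
move=> sX Xpx [c Xy]; rewrite -(subrK (c *: x) y) scalerDr.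
apply: submodD => //; first exact: submodZ.
by rewrite scalerA mulrC -scalerA; apply: submodZ.
Qed.

(** The series of [X] is intersected with [Y]: a layer containing a new element [z] of [Y] survives
    with [z] as generator, any other layer collapses. *)
Lemma has_lengthI (M : lmodType R) (X Y : set M) n :
  has_length X n -> submod Y -> exists2 m, (m <= n)%N & has_length (X `&` Y) m.
Proof.
move=> Xn sY; elim: Xn => [|{}X {}n x Xn [m mn IH] nXx Xpx].
  exists 0%N => //; suff -> : [set 0] `&` Y = [set (0 : M)] by constructor.
  by apply/seteqP; split=> [z []|z /= ->] //; split=> //; apply: submod0.
have sX := has_length_submod Xn.
case: (pselect (exists z, [/\ Y z, adjoin X x z & ~ X z])) => [[z [Yz Xxz nXz]]|h].
  exists m.+1 => //; rewrite (adjoin_eq sX Xpx Xxz nXz).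
  suff -> : adjoin X z `&` Y = adjoin (X `&` Y) z.
    constructor=> //; first by case.
    by split; [apply: adjoin_scale Xxz|apply: submodZ].
  apply/seteqP; split=> y /=.
    move=> [[c Xy] Yy]; exists c; split=> //.
    by apply: submodB => //; apply: submodZ.
  move=> [c [Xy Yy]]; split; first by exists c.
  by rewrite -(subrK (c *: z) y); apply: submodD => //; apply: submodZ.
exists m; first exact: leqW.
suff -> : adjoin X x `&` Y = X `&` Y by [].
apply/seteqP; split=> y [Xy Yy]; split=> //; last exact: sub_adjoin.
by apply: contrapT => nXy; apply: h; exists y.
Qed.

Lemma has_length_subset (M : lmodType R) (X Y : set M) n :
  has_length X n -> submod Y -> Y `<=` X ->
  exists2 m, (m <= n)%N & has_length Y m.
Proof.
by move=> Xn sY YX; have := has_lengthI Xn sY; rewrite setIidr.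
Qed.

Lemma has_length_image (M N : lmodType R) (f : {linear M -> N}) (X : set M) n :
  has_length X n -> exists m, has_length (f @` X) m.
Proof.
elim=> [|{}X {}n x Xn [m IH] nXx Xpx].
  exists 0%N; rewrite image_set1 linear0; constructor.
have sX := has_length_submod Xn; have sfX := submod_image f sX.
have -> : f @` adjoin X x = adjoin (f @` X) (f x).
  apply/seteqP; split=> y.
    move=> [z [c Xz] <-]; exists c; exists (z - c *: x) => //.
    by rewrite linearB linearZ.
  move=> [c [z Xz zE]]; exists (z + c *: x).
    by exists c; rewrite addrK.
  by rewrite linearD linearZ zE /= subrK.
case: (pselect ((f @` X) (f x))) => [fXx|nfXx].
  exists m; suff -> : adjoin (f @` X) (f x) = f @` X by [].
  apply/seteqP; split; last exact: sub_adjoin.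
  exact: adjoin_sub.
exists m.+1; constructor=> //; exists (p *: x) => //.
by rewrite linearZ.
Qed.

(** Additivity of length: the series of the image [Y] is lifted layer by layer on top of the
    kernel. *)
Lemma has_length_preimage (M N : lmodType R) (f : {linear M -> N}) (X : set M)
    (Y : set N) a b :
  has_length Y b -> submod X -> f @` X = Y ->
  has_length (X `&` [set x | f x = 0]) a -> has_length X (a + b).
Proof.
move=> Yb; elim: Yb X => [|{}Y {}b y Yb IH nYy Ypy] X sX fX Xa.
  rewrite addn0; suff <- : X `&` [set x | f x = 0] = X by [].
  apply/setIidPl => x Xx; have : (f @` X) (f x) by exists x.
  by rewrite fX.
have sY := has_length_submod Yb.
have : adjoin Y y y by apply: adjoin_self.
rewrite -fX => -[x Xx xy]; pose X' := X `&` [set z | Y (f z)].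
have sX' : submod X'.
  apply: submodI => //; split=> [|c u v] /=; first by rewrite linear0; apply: submod0.
  by rewrite linearP; case: sY => _; apply.
have XE : X = adjoin X' x.
  apply/seteqP; split=> [z Xz|]; last by apply: adjoin_sub => // z [].
  have : (f @` X) (f z) by exists z.
  rewrite fX => -[c Yz]; exists c; split.
    by apply: submodB => //; apply: submodZ.
  by rewrite /= linearB linearZ /= xy.
rewrite XE addnS; constructor; last 2 first.
- by case=> _ /=; rewrite xy.
- by split; [apply: submodZ|rewrite /= linearZ /= xy].
apply: IH => //.
  apply/seteqP; split=> [_ [z [_ Yz] <-] //|z Yz].
  have : adjoin Y y z by apply: sub_adjoin.
  by rewrite -fX => -[w Xw wz]; exists w => //; split=> //=; rewrite wz.
suff -> : X' `&` [set x | f x = 0] = X `&` [set x | f x = 0] by [].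
apply/seteqP; split=> z /=; first by case=> -[].
by move=> [Xz fz]; do 2!split=> //=; rewrite fz; apply: submod0.
Qed.

Lemma has_length0E (M : lmodType R) (X : set M) :
  has_length X 0 -> X = [set 0].
Proof. by move Em: 0%N => m Xm; case: Xm Em. Qed.

Lemma has_lengthSE (M : lmodType R) (X : set M) n : has_length X n.+1 ->
  exists Y x, [/\ X = adjoin Y x, has_length Y n, ~ Y x & Y (p *: x)].
Proof.
move Em: n.+1 => m Xm; case: Xm Em => // Y k x Yk nYx Ypx [->].
by exists Y, x.
Qed.

(** Simplicity of the layer: an element of [Y] outside [X] would generate all of [adjoin X x] over
    [X], and [y] would be in [Y]. *)
Lemma adjoin_between (M : lmodType R) (X Y : set M) x y : submod X ->
  submod Y -> X (p *: x) -> X `<=` Y -> Y `<=` adjoin X x -> adjoin X x y ->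
  ~ Y y -> Y = X.
Proof.
move=> sX sY Xpx XY YX Xxy nYy; apply/seteqP; split=> // z Yz.
apply: contrapT => nXz; apply: nYy.
have Xz := YX _ Yz; move: Xxy; rewrite (adjoin_eq sX Xpx Xz nXz).
exact: adjoin_sub.
Qed.

(* The diamond in the proof of the Jordan-Hoelder theorem: two distinct maximal
   submodules meet in a submodule which is maximal in both. *)
Lemma adjoin_diamond (M : lmodType R) (Y Y' : set M) x x' : submod Y ->
  submod Y' -> adjoin Y x = adjoin Y' x' -> Y' (p *: x') ->
  forall y, Y y -> ~ Y' y ->
  [/\ Y = adjoin (Y `&` Y') y, ~ (Y `&` Y') y & (Y `&` Y') (p *: y)].
Proof.
move=> sY sY' E Ypx' y Yy nYy; have YX : Y `<=` adjoin Y' x'.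
  by rewrite -E; apply: sub_adjoin.
split; first apply/seteqP; [split=> [z Yz|]|by case|split].
- have := YX _ Yz; rewrite (adjoin_eq sY' Ypx' (YX _ Yy) nYy) => -[c Xz].
  by exists c; split=> //; apply: submodB => //; apply: submodZ.
- by apply: adjoin_sub => // z [].
- exact: submodZ.
- exact: adjoin_scale (YX _ Yy).
Qed.

(** If the two series end with distinct maximal submodules [Y] and [Y'], let [k] be the length of
    their intersection. The induction hypothesis on [Y] yields [m = k.+1]; since [Y'] also has
    length [k.+1], the hypothesis on [Y'] then gives the equality. *)
Lemma has_length_inj (M : lmodType R) (X : set M) m n :
  has_length X m -> has_length X n -> m = n.
Proof.
elim: m X n => [|m IH] X [|n] // Xm Xn.
- have [Y [x [XE Yn nYx _]]] := has_lengthSE Xn.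
  have sY := has_length_submod Yn.
  have := adjoin_self x sY; rewrite -XE (has_length0E Xm) => x0.
  by case: nYx; rewrite x0; apply: submod0.
- have [Y [x [XE Yn nYx _]]] := has_lengthSE Xm.
  have sY := has_length_submod Yn.
  have := adjoin_self x sY; rewrite -XE (has_length0E Xn) => x0.
  by case: nYx; rewrite x0; apply: submod0.
have [Y [x [XE Ym nYx Ypx]]] := has_lengthSE Xm.
have [Y' [x' [XE' Yn nYx' Ypx']]] := has_lengthSE Xn.
have sY := has_length_submod Ym; have sY' := has_length_submod Yn.
case: (pselect (Y = Y')) => [YY'|neqY].
  by congr _.+1; apply: IH Ym _; rewrite YY'.
have E : adjoin Y x = adjoin Y' x' by rewrite -XE.
(* Two distinct maximal submodules are not nested, because nothing lies strictly between one of them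
   and the whole. *)
have not_sub (Z Z' : set M) z z' : submod Z -> submod Z' ->
    adjoin Z z = adjoin Z' z' -> Z (p *: z) -> ~ Z' z' -> Z <> Z' ->
    exists2 y, Z y & ~ Z' y.
  move=> sZ sZ' eqZ Zpz nZz' neqZ; apply: contrapT => h.
  have ZZ' : Z `<=` Z'.
    by move=> u Zu; apply: contrapT => nZu; apply: h; exists u.
  have Zz : adjoin Z z z' by rewrite eqZ; apply: adjoin_self.
  apply: neqZ; symmetry; apply: (adjoin_between sZ sZ' Zpz) Zz nZz' => //.
  by rewrite eqZ; apply: sub_adjoin.
have [y Yy nYy] := not_sub Y Y' x x' sY sY' E Ypx nYx' neqY.
have [y' Yy' nYy'] :=
  not_sub Y' Y x' x sY' sY (esym E) Ypx' nYx (nesym neqY).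
have [YE nIy Ipy] := adjoin_diamond sY sY' E Ypx' Yy nYy.
have [YE' nIy' Ipy'] := adjoin_diamond sY' sY (esym E) Ypx Yy' nYy'.
have [k _ Ik] := has_lengthI Ym sY'.
have km : m = k.+1 by apply: IH Ym _; rewrite YE; constructor.
congr _.+1; apply: (IH Y') => //; rewrite km YE'; constructor=> //.
by rewrite setIC.
Qed.

Definition finite_length (M : lmodType R) (X : set M) :=
  exists n, has_length X n.

(** The value 0 is a default for submodules without a composition series. *)
Definition length (M : lmodType R) (X : set M) : nat :=
  xget 0%N [set n | has_length X n].

Lemma lengthE (M : lmodType R) (X : set M) n : has_length X n -> length X = n.
Proof.
move=> Xn; have := @xgetPex _ 0%N [set k | has_length X k].
by move=> /(_ (ex_intro _ n Xn)) /has_length_inj; apply.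
Qed.

Lemma lengthP (M : lmodType R) (X : set M) :
  finite_length X -> has_length X (length X).
Proof. by move=> [n Xn]; rewrite (lengthE Xn). Qed.

Lemma finite_length_subset (M : lmodType R) (X Y : set M) :
  finite_length X -> submod Y -> Y `<=` X -> finite_length Y.
Proof.
by move=> [n Xn] sY YX; have [m _ Ym] := has_length_subset Xn sY YX; exists m.
Qed.

Lemma length_subset (M : lmodType R) (X Y : set M) :
  finite_length X -> submod Y -> Y `<=` X -> (length Y <= length X)%N.
Proof.
move=> [n Xn] sY YX; have [m mn Ym] := has_length_subset Xn sY YX.
by rewrite (lengthE Xn) (lengthE Ym).
Qed.

Lemma finite_length_image (M N : lmodType R) (f : {linear M -> N}) (X : set M) :
  finite_length X -> finite_length (f @` X).
Proof. by move=> [n Xn]; apply: has_length_image Xn. Qed.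

Lemma length_ker_image (M N : lmodType R) (f : {linear M -> N}) (X : set M) :
  finite_length X ->
  length X = (length (X `&` [set x | f x = 0%R]) + length (f @` X))%N.
Proof.
move=> [n Xn]; have sX := has_length_submod Xn.
apply: lengthE; apply: (has_length_preimage (f := f)) => //.
- by apply/lengthP/finite_length_image; exists n.
apply: lengthP; have [m _ Im] := has_lengthI Xn (submod_ker f).
by exists m.
Qed.

Lemma length_image_inj (M N : lmodType R) (f : {linear M -> N}) (X : set M) :
  finite_length X -> injective f -> length (f @` X) = length X.
Proof.
move=> Xf fI; rewrite (length_ker_image f Xf).
suff -> : X `&` [set x | f x = 0] = [set (0 : M)].
  by rewrite (lengthE (has_length0 M)).
apply/seteqP; split=> [x [_ /= fx]|x /= ->].
  by apply: fI; rewrite fx linear0.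
by split; [case: Xf => n /has_length_submod/submod0|rewrite /= linear0].
Qed.

End Length.

Lemma factor_linear (R : pzRingType) (U V W : lmodType R) (f : {linear U -> V})
    (g : {linear U -> W}) :
  (forall v, exists u, f u = v) -> (forall u, f u = 0 -> g u = 0) ->
  exists h : {linear V -> W}, forall u, h (f u) = g u.
Proof.
move=> f_surj fg; have [s fs] := choice f_surj.
have gE u u' : f u = f u' -> g u = g u'.
  by move=> E; apply/subr0_eq; rewrite -linearB fg // linearB E /= subrr.
have lin : linear (g \o s).
  by move=> a x y; rewrite /= -linearP; apply: gE; rewrite linearP !fs.
by exists (Linear_of lin) => u; apply: gE; rewrite fs.
Qed.

(** * Lattices *)

Section PrimePower.
Variables (R : idomainType) (p : R).
Hypothesis p_neq0 : p != 0.
Hypothesis p_nonunit : p \isn't a GRing.unit.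

Definition pdvd (m : nat) (x : R) : Prop := exists c, x = c * p ^+ m.

Lemma pdvd0 m : pdvd m 0.
Proof. by exists 0; rewrite mul0r. Qed.

Lemma pdvd_all x : pdvd 0 x.
Proof. by exists x; rewrite mulr1. Qed.

Lemma pdvdX m : pdvd m (p ^+ m).
Proof. by exists 1; rewrite mul1r. Qed.

Lemma pdvdD m x y : pdvd m x -> pdvd m y -> pdvd m (x + y).
Proof. by move=> [c ->] [d ->]; exists (c + d); rewrite mulrDl. Qed.

Lemma pdvdN m x : pdvd m x -> pdvd m (- x).
Proof. by move=> [c ->]; exists (- c); rewrite mulNr. Qed.

Lemma pdvdB m x y : pdvd m x -> pdvd m y -> pdvd m (x - y).
Proof. by move=> px py; apply: pdvdD => //; apply: pdvdN. Qed.

Lemma pdvdM m a x : pdvd m x -> pdvd m (a * x).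
Proof. by move=> [c ->]; exists (a * c); rewrite mulrA. Qed.

Lemma pdvd_leq m k x : (k <= m)%N -> pdvd m x -> pdvd k x.
Proof.
by move=> km [c ->]; exists (c * p ^+ (m - k)); rewrite -mulrA -exprD subnK.
Qed.

Lemma pdvd_mulX m k x : pdvd (m + k) (p ^+ k * x) <-> pdvd m x.
Proof.
split=> -[c E]; exists c; last by rewrite E exprD mulrC -mulrA.
apply: (mulfI (expf_neq0 k p_neq0)).
by rewrite E exprD mulrA mulrC.
Qed.

Lemma pdvd_mulXsub b k x : pdvd b (p ^+ k * x) <-> pdvd (b - k) x.
Proof.
have [kb|bk] := leqP k b; first by rewrite -{1}(subnK kb) pdvd_mulX.
have -> : (b - k = 0)%N by apply/eqP; rewrite subn_eq0 ltnW.
split=> _; first exact: pdvd_all.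
by rewrite mulrC; apply: pdvdM; apply: pdvd_leq (pdvdX k); apply: ltnW.
Qed.

(** For [k < m], cancelling [p ^+ k] would make [p] a unit. *)
Lemma pdvd_exp m k : pdvd m (p ^+ k) -> (m <= k)%N.
Proof.
have [//|km [c E]] := leqP m k; exfalso.
move/negP: p_nonunit; apply; apply/unitrP.
exists (c * p ^+ (m - k.+1)).
suff E1 : c * p ^+ (m - k.+1) * p = 1 by rewrite [p * _]mulrC E1.
apply: (mulfI (expf_neq0 k p_neq0)).
rewrite mulr1 [RHS]E -[in RHS](subnK km) exprD exprS.
by rewrite mulrC -!mulrA.
Qed.

Definition lattice n (b : nat -> nat) : set 'rV[R]_n :=
  [set x | forall j : 'I_n, pdvd (b j) (x 0 j)].

Lemma submod_lattice n b : submod (lattice (n := n) b).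
Proof.
split=> [j|a x y xL yL j]; rewrite !mxE; first exact: pdvd0.
by apply: pdvdD => //; apply: pdvdM.
Qed.

Lemma lattice_leq n (b c : nat -> nat) :
  (forall j : 'I_n, (c j <= b j)%N) -> lattice (n := n) b `<=` lattice c.
Proof. by move=> cb x xL j; apply: pdvd_leq (xL j). Qed.

Lemma lattice_scale n (b : nat -> nat) k (x : 'rV[R]_n) :
  lattice b (p ^+ k *: x) <-> lattice (fun j => b j - k)%N x.
Proof. by split=> xL j; have := xL j; rewrite !mxE pdvd_mulXsub. Qed.

(** A presentation of [M] as the direct sum of the cyclic modules R/(p^(b j)). Zero exponents are
    allowed, so that modules with different numbers of summands can share the same R^n. *)
Definition coordinates (M : lmodType R) n (b : nat -> nat)
    (phi : {linear 'rV[R]_n -> M}) : Prop :=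
  (forall m, exists x, phi x = m) /\ forall x, phi x = 0 <-> lattice b x.

(** Raising one exponent [c j] below [b j] by one removes a simple layer, generated by the image of
    [p ^+ c j] times the [j]-th basis vector. This layer is nonzero because [p ^+ c j] is not
    divisible by [p ^+ (c j).+1]. *)
Lemma length_lattice (M : lmodType R) n (b c : nat -> nat)
    (phi : {linear 'rV[R]_n -> M}) :
  (forall x, phi x = 0 <-> lattice b x) -> (forall j : 'I_n, c j <= b j)%N ->
  has_length p (phi @` lattice c) (\sum_(j < n) (b j - c j)).
Proof.
move=> kerE; move Ek: (\sum_(j < n) _)%N => k; elim: k c Ek => [|k IH] c Ek cb.
  suff -> : phi @` lattice c = [set 0] by constructor.
  apply/seteqP; split=> [_ [x xL <-]|_ ->].
    apply/kerE; apply: lattice_leq xL => j; rewrite -subn_eq0.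
    by move/eqP: Ek; rewrite sum_nat_eq0 => /forallP /(_ j).
  by exists 0; rewrite ?linear0 //; apply: submod0 (submod_lattice _ _).
have [j cbj] : exists j : 'I_n, (c j < b j)%N.
  apply: contrapT => h.
  suff : (\sum_(j < n) (b j - c j) = 0)%N by rewrite Ek.
  apply: big1 => j _; apply/eqP; rewrite subn_eq0 leqNgt; apply/negP => cbj.
  by apply: h; exists j.
pose c' i := if i == j :> nat then (c j).+1 else c i.
have c'j : c' j = (c j).+1 by rewrite /c' eqxx.
have c'i (i : 'I_n) : i != j -> c' i = c i.
  by move=> ij; rewrite /c' -[_ == _ :> nat]/(i == j) (negbTE ij).
have c'b (i : 'I_n) : (c' i <= b i)%N.
  by case: (eqVneq i j) => [->|ij]; rewrite ?c'j ?c'i.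
have Ek' : (\sum_(j < n) (b j - c' j) = k)%N.
  apply/eqP; rewrite -eqSS -Ek (bigD1 j) // [in X in _ == X](bigD1 j) //= c'j.
  rewrite -addSn -subSn // subSS; apply/eqP; congr (_ + _)%N.
  by apply: eq_bigr => i ij; rewrite c'i.
pose e : 'rV[R]_n := p ^+ c j *: delta_mx 0 j.
have ej : e 0 j = p ^+ c j by rewrite !mxE !eqxx mulr1.
have ei i : i != j -> e 0 i = 0 by move=> ij; rewrite !mxE (negbTE ij) andbF mulr0.
have sc'c : lattice (n := n) c' `<=` lattice c.
  apply: lattice_leq => i; case: (eqVneq i j) => [->|ij]; rewrite ?c'j ?c'i //.
have -> : phi @` lattice c = adjoin (phi @` lattice c') (phi e).
  apply/seteqP; split.
    move=> _ [x xL <-]; have [a xj] := xL j; exists a; exists (x - a *: e).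
      move=> i; case: (eqVneq i j) => [->|ij]; rewrite !mxE.
        by rewrite !eqxx mulr1 xj subrr; apply: pdvd0.
      by rewrite (negbTE ij) andbF !mulr0 subr0 c'i.
    by rewrite linearB linearZ.
  apply: adjoin_sub; first exact/submod_image/submod_lattice.
    by move=> _ [x xL <-]; exists x => //; apply: sc'c.
  exists e => // i; case: (eqVneq i j) => [->|ij].
    by rewrite ej; apply: pdvdX.
  by rewrite ei //; apply: pdvd0.
constructor; first exact: IH.
  move=> [y yL /esym E]; have /kerE eyL : phi (e - y) = 0.
    by rewrite linearB E /= subrr.
  suff : pdvd (c j).+1 (p ^+ c j) by move/pdvd_exp; rewrite ltnn.
  have := eyL j; rewrite !mxE !eqxx mulr1 => ebj.
  rewrite -(subrK (y 0 j) (p ^+ c j)); apply: pdvdD; first exact: pdvd_leq ebj.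
  by rewrite -c'j; apply: yL.
exists (p *: e); last by rewrite linearZ.
move=> i; case: (eqVneq i j) => [->|ij].
  by rewrite c'j mxE ej -exprS; apply: pdvdX.
by rewrite mxE ei // mulr0; apply: pdvd0.
Qed.

(** Coordinates past the end of [lam] get the exponent 0, the default of [nth], and vanish in the
    quotient. *)
Lemma partition_coordinates (lam : seq nat) n : (size lam <= n)%N ->
  exists phi : {linear 'rV[R]_n -> partition_module p lam},
    coordinates (nth 0%N lam) phi.
Proof.
elim: lam n => [|l lam IH] n szn.
  have lin : linear (fun _ : 'rV[R]_n => 0 : 'rV[R]_0).
    by move=> a x y; rewrite scaler0 addr0.
  exists (Linear_of lin); split=> [m|x]; first by exists 0; apply/rowP => -[].
  by split=> // _ j; rewrite nth_nil; apply: pdvd_all.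
case: n szn => // n; rewrite ltnS => /IH [phi [phi_surj phi_ker]].
pose tl (x : 'rV[R]_n.+1) : 'rV[R]_n := \row_j x 0 (lift ord0 j).
pose f (x : 'rV[R]_n.+1) := (cyclic_pi (p ^+ l) (x 0 ord0), phi (tl x))
  : partition_module p (l :: lam).
have lin : linear f.
  move=> a x y; rewrite /f; congr (_, _).
    by rewrite !mxE cyclic_piD; congr (_ + _); symmetry; apply: cyclic_scale_pi.
  have -> : tl (a *: x + y) = a *: tl x + tl y by apply/rowP => j; rewrite !mxE.
  exact: linearP.
exists (Linear_of lin); split=> [[q m]|x].
  have [y <-] := phi_surj m.
  exists (\row_j oapp (y 0) (repr q) (unlift ord0 j)).
  rewrite /= /f mxE unlift_none /= cyclic_reprK; congr (_, phi _).
  by apply/rowP => j; rewrite !mxE liftK.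
have pi0 : cyclic_pi (p ^+ l) 0 = 0 by exact: raddf0.
rewrite /= /f; split.
  move=> [/eqP x0 /phi_ker tx] j; case: (unliftP ord0 j) => [i|] ->.
    by have := tx i; rewrite mxE lift0.
  by move: x0; rewrite -pi0 => /cyclic_piP [r]; rewrite subr0 => ->; exists r.
move=> xL; congr (_, _).
  by apply/eqP; rewrite -pi0; apply/cyclic_piP; rewrite subr0; apply: (xL ord0).
by apply/phi_ker => j; rewrite mxE; have := xL (lift ord0 j); rewrite lift0.
Qed.

Lemma partition_type_coordinates (M : lmodType R) (lam : seq nat) :
  has_partition_type p M lam ->
  exists phi : {linear 'rV[R]_(size lam) -> M}, coordinates (nth 0%N lam) phi.
Proof.
move=> [f [g fK gK]]; have [phi [phi_surj phi_ker]] :=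
  partition_coordinates (leqnn (size lam)).
have lin : linear g by apply: (can2_linear fK gK).
exists (Linear_of lin \o phi); split=> [m|x] /=.
  by have [x xE] := phi_surj (f m); exists x; rewrite xE fK.
rewrite -phi_ker; split=> [E|->]; last by rewrite -(fK 0) linear0.
by rewrite -(gK (phi x)) E linear0.
Qed.

End PrimePower.

(** * Modules of finite length are sums of cyclic modules *)

Section Structure.
Variables (R : idomainType) (p : R).
Hypothesis unit_or_multiple :
  forall x : R, x \is a GRing.unit \/ exists y, x = y * p.
Hypothesis p_neq0 : p != 0.
Variables (M : lmodType R) (X : set M).
Hypothesis Xfin : finite_length p X.

Let sX : submod X.
Proof. by case: Xfin => n /has_length_submod. Qed.

(** Coefficients are functions on [nat], so that appending a vector requires no change of type. *)
Definition lincomb (vs : seq M) (c : nat -> R) : M :=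
  \sum_(j < size vs) c j *: vs`_j.

Lemma lincomb_ext (vs : seq M) c d :
  (forall j, (j < size vs)%N -> c j = d j) -> lincomb vs c = lincomb vs d.
Proof. by move=> cd; apply: eq_bigr => j _; rewrite cd. Qed.

Lemma lincombZ (vs : seq M) a c :
  lincomb vs (fun j => a * c j) = a *: lincomb vs c.
Proof. by rewrite scaler_sumr; apply: eq_bigr => j _; rewrite scalerA. Qed.

Lemma lincomb_rcons (vs : seq M) v c :
  lincomb (rcons vs v) c = lincomb vs c + c (size vs) *: v.
Proof.
rewrite /lincomb size_rcons big_ord_recr /= nth_rcons ltnn eqxx.
by congr (_ + _); apply: eq_bigr => j _; rewrite nth_rcons ltn_ord.
Qed.

Lemma lincomb_rcons_if (vs : seq M) v c a :
  lincomb (rcons vs v) (fun j => if (j < size vs)%N then c j else a) =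
  lincomb vs c + a *: v.
Proof.
rewrite lincomb_rcons ltnn; congr (_ + _).
by apply: lincomb_ext => j ->.
Qed.

Lemma submod_lincomb (vs : seq M) c :
  (forall j, (j < size vs)%N -> X vs`_j) -> X (lincomb vs c).
Proof.
move=> vsX; apply: (big_ind X) => [|x y|j _]; first exact: submod0.
  exact: submodD.
by apply: submodZ => //; apply: vsX.
Qed.

(* The vectors [vs] generate a copy of the module of type [lam] modulo the
   elements killed by [p ^+ i]. *)
Definition independent_mod (i : nat) (vs : seq M) (lam : seq nat) : Prop :=
  [/\ size lam = size vs, is_partition lam,
      forall j, (j < size vs)%N -> X vs`_j
    & forall c, p ^+ i *: lincomb vs c = 0 <->
        forall j, (j < size vs)%N -> pdvd p (nth 0%N lam j) (c j)].

Definition spanning_mod (i : nat) (vs : seq M) : Prop :=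
  forall x, X x -> exists c, p ^+ i *: (x - lincomb vs c) = 0.

Let span_mod i vs : set M :=
  X `&` [set x | exists c, p ^+ i *: (x - lincomb vs c) = 0].

Lemma submod_span_mod i vs : submod (span_mod i vs).
Proof.
apply: submodI => //; split.
  exists (fun=> 0); rewrite sub0r /lincomb big1 ?oppr0 ?scaler0 // => j _.
  by rewrite scale0r.
move=> a x y [c cE] [d dE]; exists (fun j => a * c j + d j).
suff -> : lincomb vs (fun j => a * c j + d j) = a *: lincomb vs c + lincomb vs d.
  rewrite opprD addrACA -scalerBr scalerDr dE addr0.
  by rewrite scalerA mulrC -scalerA cE scaler0.
rewrite -lincombZ /lincomb -big_split; apply: eq_bigr => j _ /=.
by rewrite scalerDl.
Qed.

(** In a relation the coefficient of [v] cannot be a unit, as [v] is outside the span; hence it is a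
    multiple of [p]. That term is then killed by [p ^+ i], which leaves a relation among [vs]. *)
Lemma independent_mod_rcons i vs lam v : independent_mod i vs lam -> X v ->
  p ^+ i.+1 *: v = 0 -> ~ span_mod i vs v ->
  independent_mod i (rcons vs v) (rcons lam 1%N).
Proof.
move=> [szE lamP vsX indep] Xv pv nspan; split.
- by rewrite !size_rcons szE.
- case/andP: lamP => lam_sorted lam_pos; apply/andP; split; last first.
    by rewrite all_rcons lam_pos.
  case: (lam) lam_sorted (allP lam_pos) => //= l lam' ls pos.
  by rewrite rcons_path ls; apply: pos (mem_last l lam').
- move=> j; rewrite size_rcons nth_rcons ltnS leq_eqVlt => /orP[/eqP ->|jn].
    by rewrite ltnn eqxx.
  by rewrite jn; apply: vsX.
have key c : p ^+ i *: (lincomb vs c + c (size vs) *: v) = 0 ->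
    pdvd p 1 (c (size vs)).
  move=> E; case: (unit_or_multiple (c (size vs))) => [cU|[d ->]]; last by exists d.
  case: nspan; split=> //; exists (fun j => - (c (size vs))^-1 * c j).
  rewrite lincombZ scaleNr opprK addrC -[X in _ + X]scale1r -(mulVr cU).
  by rewrite -scalerA -scalerDr scalerA mulrC -scalerA E scaler0.
have killed a : pdvd p 1 a -> p ^+ i *: (a *: v) = 0.
  by move=> [d ->]; rewrite scalerA mulrCA expr1 -exprSr -scalerA pv scaler0.
move=> c; rewrite lincomb_rcons; split.
  move=> E j; rewrite size_rcons ltnS leq_eqVlt => /orP[/eqP ->|jn].
    by rewrite -szE nth_rcons ltnn eqxx szE; apply: key.
  rewrite nth_rcons szE jn; have /indep : p ^+ i *: lincomb vs c = 0; last exact.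
  by move: (E); rewrite scalerDr killed ?addr0 //; apply: key.
move=> H; rewrite scalerDr killed ?addr0; last first.
  by have := H (size vs); rewrite size_rcons -szE nth_rcons ltnn eqxx; apply.
apply/indep => j jn; have := H j; rewrite size_rcons ltnS nth_rcons szE jn.
by apply; apply: ltnW.
Qed.

(** While some [x] is missed, spanning at level [i.+1] gives a combination whose difference [v] from
    [x] is killed by [p ^+ i.+1]. Appending [v] makes the span strictly longer, and the length of
    [X] bounds the process. *)
Lemma independent_mod_extend i vs lam :
  independent_mod i vs lam -> spanning_mod i.+1 vs ->
  exists vs' lam', independent_mod i vs' lam' /\ spanning_mod i vs'.
Proof.
move Ek: (length p X - length p (span_mod i vs))%N => k.
elim/ltn_ind: k vs lam Ek => k IH vs lam Ek ind span.
case: (pselect (spanning_mod i vs)) => [sp|nsp]; first by exists vs, lam.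
have [x Xx nx] : exists2 x, X x & ~ exists c, p ^+ i *: (x - lincomb vs c) = 0.
  apply: contrapT => h; apply: nsp => x Xx; apply: contrapT => nx.
  by apply: h; exists x.
have [c xc] := span x Xx; have vsX := let: And4 _ _ vsX _ := ind in vsX.
pose v := x - lincomb vs c.
have Xv : X v by apply: submodB => //; apply: submod_lincomb.
have lincombD d e :
    lincomb vs (fun j => d j + e j) = lincomb vs d + lincomb vs e.
  by rewrite /lincomb -big_split; apply: eq_bigr => j _; rewrite scalerDl.
have nv : ~ span_mod i vs v.
  move=> [_ [d vd]]; apply: nx; exists (fun j => c j + d j).
  by rewrite lincombD opprD addrA.
have ind' := independent_mod_rcons ind Xv xc nv.
have spanX ws : span_mod i ws `<=` X by move=> ? [].
have fin ws : finite_length p (span_mod i ws).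
  exact: finite_length_subset Xfin (submod_span_mod _ _) (spanX _).
have spanE : span_mod i (rcons vs v) = adjoin (span_mod i vs) v.
  apply/seteqP; split=> y.
    move=> [Xy [d yd]]; exists (d (size vs)); split.
      by apply: submodB => //; apply: submodZ.
    by exists d; move: yd; rewrite lincomb_rcons opprD [- _ - _]addrC addrA.
  move=> [a [Xy [d yd]]]; split.
    by rewrite -(subrK (a *: v) y); apply: submodD => //; apply: submodZ.
  exists (fun j => if (j < size vs)%N then d j else a).
  by rewrite lincomb_rcons_if opprD [- _ - _]addrC addrA.
have lenE : length p (span_mod i (rcons vs v)) = (length p (span_mod i vs)).+1.
  rewrite spanE; apply: lengthE => //; constructor=> //; first exact: lengthP.
  split; first exact: submodZ.
  exists (fun=> 0); rewrite /lincomb big1 ?subr0; last by move=> j _; rewrite scale0r.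
  by rewrite scalerA -exprSr.
have lenX : (length p (span_mod i (rcons vs v)) <= length p X)%N.
  exact: length_subset (submod_span_mod _ _) (spanX _).
apply: (IH _ _ (rcons vs v) _ erefl ind').
  by rewrite -Ek lenE subnS ltn_predL subn_gt0 -lenE.
move=> y /span [d yd]; exists (fun j => if (j < size vs)%N then d j else 0).
by rewrite lincomb_rcons_if scale0r addr0.
Qed.

(** Passing from multiples by [p ^+ i.+1] to multiples by [p ^+ i] lengthens each cyclic summand by
    one. *)
Lemma independent_mod_lift i vs lam :
  independent_mod i.+1 vs lam -> independent_mod i vs (map S lam).
Proof.
move=> [szE /andP[lam_sorted lam_pos] vsX indep]; split=> //.
- by rewrite size_map.
- apply/andP; split; first by rewrite sorted_map.
  by apply/allP => _ /mapP[l _ ->].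
have nthE j : (j < size vs)%N -> nth 0%N (map S lam) j = (nth 0%N lam j).+1.
  by move=> jn; rewrite (nth_map 0%N) // szE.
move=> c; split.
  move=> E; have /indep cd : p ^+ i.+1 *: lincomb vs c = 0.
    by rewrite exprS -scalerA E scaler0.
  have H j : exists d, (j < size vs)%N -> c j = d * p ^+ nth 0%N lam j.
    case: (boolP (j < size vs)%N) => [/cd [d ->]|]; first by exists d.
    by exists 0.
  have [d dE] := choice H.
  have lam_gt0 j : (j < size vs)%N -> (0 < nth 0%N lam j)%N.
    by move=> jn; apply: (allP lam_pos); rewrite mem_nth // szE.
  (* Parts are positive, so one factor [p] can be moved from the coefficients to the scalar;
     independence at level [i.+1] then applies a second time and yields the extra power. *)
  have /indep cd' : p ^+ i.+1 *:
      lincomb vs (fun j => d j * p ^+ (nth 0%N lam j).-1) = 0.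
    rewrite exprSr -scalerA -lincombZ -E; congr (_ *: _).
    apply: lincomb_ext => j jn; rewrite dE // mulrCA -exprS prednK //.
    exact: lam_gt0.
  move=> j jn; rewrite nthE // dE // mulrC.
  rewrite -addn1 addnC pdvd_mulX //; have := cd' j jn.
  rewrite -{1}(prednK (lam_gt0 j jn)) mulrC -add1n.
  by rewrite pdvd_mulX.
move=> H; have {}H j : exists d, (j < size vs)%N ->
    c j = p * (d * p ^+ nth 0%N lam j).
  case: (boolP (j < size vs)%N) => [jn|]; last by exists 0.
  have := H j jn; rewrite nthE // => -[d ->]; exists d => _.
  by rewrite exprS mulrCA.
have [d dE] := choice H.
rewrite (lincomb_ext dE) lincombZ scalerA -exprSr.
by apply/indep => j jn; exists (d j).
Qed.

(** Descending induction on the level, from [N], where the empty family works because [X] is killed,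
    down to 0. *)
Lemma exists_basis N : (forall x, X x -> p ^+ N *: x = 0) ->
  exists vs lam, independent_mod 0 vs lam /\ spanning_mod 0 vs.
Proof.
move=> XN; suff /(_ N (leqnn N)) : forall k, (k <= N)%N ->
    exists vs lam, independent_mod (N - k) vs lam /\ spanning_mod (N - k) vs.
  by rewrite subnn.
elim=> [_|k IH kN]; last first.
  have [vs [lam [ind span]]] := IH (ltnW kN).
  rewrite -(subnSK kN) in ind span.
  exact: independent_mod_extend (independent_mod_lift ind) span.
rewrite subn0; exists [::], [::].
have lin0 c : lincomb [::] c = 0 by rewrite /lincomb big_ord0.
split; first by split=> // c; rewrite lin0 scaler0.
by move=> x /XN xN; exists (fun=> 0); rewrite lin0 subr0.
Qed.

Theorem finite_length_coordinates N : (forall x, X x -> p ^+ N *: x = 0) ->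
  exists2 lam, is_partition lam & exists2 phi : {linear 'rV[R]_(size lam) -> M},
    range phi = X & forall x, phi x = 0 <-> lattice p (nth 0%N lam) x.
Proof.
move=> /exists_basis [vs [lam [[szE lamP vsX indep] span]]].
exists lam => //.
have lin : linear (fun x : 'rV[R]_(size lam) => \sum_j x 0 j *: vs`_j).
  move=> a x y; rewrite scaler_sumr -big_split; apply: eq_bigr => j _ /=.
  by rewrite !mxE scalerDl scalerA.
pose coef (x : 'rV[R]_(size lam)) k := oapp (x 0) 0 (insub k).
have coefE x (j : 'I_(size lam)) : coef x j = x 0 j by rewrite /coef valK.
pose phi := Linear_of lin.
have linE x : phi x = lincomb vs (coef x).
  by rewrite /lincomb -szE; apply: eq_bigr => j _; rewrite coefE.
exists phi.
- apply/seteqP; split.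
    by move=> _ [x _ <-]; rewrite linE; apply: submod_lincomb.
  move=> y /span [c]; rewrite expr0 scale1r => /subr0_eq ->.
  exists (\row_j c j) => //; rewrite linE; apply: lincomb_ext => j.
  by rewrite -szE => jn; rewrite -[j]/(val (Ordinal jn)) coefE mxE.
move=> x; rewrite linE -[lincomb _ _]scale1r -(expr0 p) indep -szE.
split=> [H j|H j jn]; first by rewrite -coefE; apply: H.
by rewrite -[j]/(val (Ordinal jn)) coefE; apply: H.
Qed.

End Structure.

(** * Tableaux from chains of partitions *)

(** Both sides say that the box in row [i] and column [j], counted from 0, belongs to the diagram of
    [lam]. *)
Lemma transpose_part_gt (lam : seq nat) i j : is_partition lam ->
  (j < transpose_part lam i.+1)%N = (i < nth 0%N lam j)%N.
Proof.
rewrite /transpose_part; elim: lam j => [|l lam IH] j; first by rewrite nth_nil.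
move=> /andP[/= ls /andP[_ lam_pos]].
have {}IH k := IH k (introT andP (conj (path_sorted ls) lam_pos)).
rewrite /=; case: (ltnP i l) => il.
  by case: j => [|j] /=; rewrite add1n // ltnS IH.
have count0 : count (leq i.+1) lam = 0%N.
  apply/eqP; rewrite -leqn0 leqNgt IH -leqNgt.
  by case: (lam) ls => //= k lam' /andP[kl _]; apply: leq_trans kl il.
rewrite count0 ltn0; case: j => [|j] /=; first by rewrite ltnNge il.
by rewrite -IH count0.
Qed.

Lemma sum_nat_window a b k : (a <= b)%N ->
  (\sum_(j < k) (a <= j < b) = minn b k - minn a k)%N.
Proof.
move=> ab; elim: k => [|k IH]; first by rewrite big_ord0 !minn0.
by rewrite big_ord_recr /= IH; case: (leqP a k) => ?; case: (ltnP k b) => ?; lia.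
Qed.

Lemma big_nat_restrict (m n N : nat) (F : nat -> nat) : (n <= N)%N ->
  (\sum_(m <= r < n) F r = \sum_(r < N | m <= r < n) F r)%N.
Proof.
move=> nN; rewrite -(big_mkord (fun r => m <= r < n)%N F).
rewrite (big_nat_widenl _ 0) // (big_nat_widen _ _ _ _ _ nN).
by apply: eq_bigl => r /=; rewrite andbC.
Qed.

Section TableauOfRows.
Variables (alp bet gam : seq nat) (h : nat -> nat -> nat) (s N : nat).
Hypotheses (bet_part : is_partition bet) (gam_part : is_partition gam).
Hypothesis size_eq : (sumn alp + sumn gam = sumn bet)%N.
(* [h r i] is the length of row [r] of the [i]-th partition of a chain which
   starts at [bet] and ends at [gam]; no row reaches the index [N.-1]. *)
Hypothesis h_start : forall r, h r 0 = transpose_part bet r.+1.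
Hypothesis h_end : forall r i, (s <= i)%N -> h r i = transpose_part gam r.+1.
Hypothesis h_decr : forall r i, (h r i.+1 <= h r i)%N.
Hypothesis h_strip : forall r i, (h r.+1 i <= h r i.+1)%N.
Hypothesis N_gt0 : (0 < N)%N.
Hypothesis bet_ltN : forall j, (nth 0 bet j < N)%N.

(** The number of entries [i.+1] in the rows from [m] on. The lattice hypothesis below uses these
    row counts, whereas (ST-3) counts by columns. *)
Let boxes i m := (\sum_(m <= r < N) (h r i - h r i.+1))%N.

Hypothesis boxes_lattice : forall m i, (boxes i.+1 m <= boxes i m.+1)%N.
Hypothesis boxes_content : forall i, boxes i 0 = transpose_part alp i.+1.

(** The number of partitions among the first [s] of the chain that contain the box; it is [i.+1] for
    a box removed between steps [i] and [i.+1]. *)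
Let T r j := (\sum_(i < s) (j < h r i))%N.

Let h_le r i k : (i <= k)%N -> (h r k <= h r i)%N.
Proof.
elim: k => [|k IH]; first by rewrite leqn0 => /eqP ->.
rewrite leq_eqVlt => /orP[/eqP -> //|]; rewrite ltnS => /IH.
exact: leq_trans (h_decr _ _).
Qed.

Let h_row r i : (h r.+1 i <= h r i)%N.
Proof. exact: leq_trans (h_strip r i) (h_decr r i). Qed.

Let h_rows r q i : (r <= q)%N -> (h q i <= h r i)%N.
Proof.
elim: q => [|q IH]; first by rewrite leqn0 => /eqP ->.
rewrite leq_eqVlt => /orP[/eqP -> //|]; rewrite ltnS => /IH.
exact: leq_trans (h_row _ _).
Qed.

Let in_skewE r j : in_skew bet gam r j = (h r s <= j < h r 0)%N.
Proof.
rewrite /in_skew h_start h_end // transpose_part_gt // leqNgt.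
by rewrite -transpose_part_gt // -leqNgt.
Qed.

(** The lengths [h r i] decrease in [i], so the indices counted by [T r j] form an initial
    segment. *)
Let T_le r j i : (h r s <= j)%N -> (T r j <= i)%N = (h r i <= j)%N.
Proof.
move=> hsj; have [is_|si] := ltnP i s; last first.
  rewrite (leq_trans (h_le r si)) //.
  rewrite (leq_trans _ si) // /T -[X in (_ <= X)%N]card_ord -sum1_card.
  by apply: leq_sum => k _; apply: leq_b1.
apply/idP/idP.
  apply: contraLR; rewrite -!ltnNge => jh.
  have -> : i.+1 = (\sum_(k < s) (k < i.+1))%N.
    by rewrite (@sum_nat_window 0) // min0n subn0; lia.
  apply: leq_sum => k _; case: ltnP => // ki.
  by rewrite (leq_trans jh) // h_le.
move=> hj; have -> : i = (\sum_(k < s) (k < i))%N.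
  by rewrite (@sum_nat_window 0) // min0n subn0; lia.
apply: leq_sum => k _; case: ltnP => // jk; case: ltnP => // ik.
by move: (leq_trans jk (h_le r ik)); rewrite ltnNge hj.
Qed.

Let T_eq r j i : (h r s <= j)%N ->
  (T r j == i.+1) = (h r i.+1 <= j < h r i)%N.
Proof.
move=> hsj; rewrite eqn_leq T_le //; congr (_ && _).
by rewrite ltnNge T_le // -ltnNge.
Qed.

Let entries_leftE k i : entries_left bet gam T k i.+1 =
  (\sum_(r < N) (minn (h r i) k - minn (h r i.+1) k))%N.
Proof.
transitivity (\sum_(j < k) \sum_(r < N)
    if in_skew bet gam r j then (T r j == i.+1 : nat) else 0)%N.
  apply: eq_bigr => j _.
  have -> := @big_nat_restrict (nth 0%N gam j) _ N
    (fun r => (T r j == i.+1) : nat) (ltnW (bet_ltN j)).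
  exact: big_mkcond.
rewrite exchange_big /=; apply: eq_bigr => r _.
rewrite -sum_nat_window //; apply: eq_bigr => j _.
rewrite in_skewE.
case: (leqP (h r s) j) => hsj /=; last first.
  suff -> : (h r i.+1 <= j < h r i)%N = false by [].
  apply/negbTE/negP => /andP[hij jhi]; case: (leqP s i) => si.
    by move: hij hsj; rewrite !h_end // 1?leqW // leqNgt => /negbTE ->.
  by move: (leq_trans (h_le r si) hij); rewrite leqNgt hsj.
rewrite T_eq //; case: (ltnP j (h r 0)) => // h0j.
by rewrite [(j < h r i)%N]ltnNge (leq_trans (h_le r (leq0n i)) h0j) andbF.
Qed.

(** From the row form of the lattice condition to the column form. Let [m] be the first row with
    [h m i.+1 <= k]. By the strip condition, entries [i.+2] before column [k] occur only in the row
    just above [m] and in the rows from [m] on, while every entry [i.+1] below row [m] is before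
    column [k]. *)
Lemma boxes_left_lattice k i :
  (\sum_(r < N) (minn (h r i.+1) k - minn (h r i.+2) k) <=
   \sum_(r < N) (minn (h r i) k - minn (h r i.+1) k))%N.
Proof.
have hN0 : h N.-1 i.+1 = 0%N.
  apply/eqP; rewrite -leqn0 (leq_trans (h_le _ (leq0n _))) // h_start.
  by rewrite leqNgt transpose_part_gt // -leqNgt -ltnS prednK.
have ex_m : exists m, (h m i.+1 <= k)%N by exists N.-1; rewrite hN0.
case: (ex_minnP ex_m) => m hmk m_min.
have mN : (m < N)%N by rewrite -(prednK N_gt0) ltnS m_min // hN0.
rewrite -!(big_mkord xpredT (fun r => minn (h r _) k - minn (h r _) k)%N).
rewrite (big_cat_nat _ (ltnW mN)) // [X in (_ <= X)%N](big_cat_nat _ (ltnW mN)) //=.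
have tail : (\sum_(m <= r < N) (minn (h r i.+1) k - minn (h r i.+2) k) <=
             boxes i.+1 m)%N.
  by apply: leq_sum => r _; move: (h_decr r i.+1); lia.
have head : (\sum_(0 <= r < m) (minn (h r i.+1) k - minn (h r i.+2) k) =
             if m is q.+1 then k - minn (h q i.+2) k else 0)%N.
  case Em : m => [|q]; first by rewrite big_geq.
  have gt_k r : (r < m)%N -> (k < h r i.+1)%N.
    by move=> rm; rewrite ltnNge; apply/negP => /m_min; rewrite leqNgt rm.
  rewrite big_nat_recr //= big_nat_cond big1 ?add0n => [|r].
    by rewrite (minn_idPr (ltnW (gt_k _ _))) // Em.
  rewrite andbT => /andP[_ rq].
  have k1 := gt_k r; have k2 := gt_k r.+1; have := h_strip r i.+1.
  rewrite Em in k1 k2; move: (k1 (ltnW rq)) (k2 rq); lia.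
rewrite head; apply: (leq_trans (leq_add (leqnn _) tail)).
suff : ((if m is q.+1 then k - minn (h q i.+2) k else 0) + boxes i.+1 m <=
        \sum_(m <= r < N) (minn (h r i) k - minn (h r i.+1) k))%N.
  by move/leq_trans; apply; apply: leq_addl.
rewrite big_ltn //.
have -> : (\sum_(m.+1 <= r < N) (minn (h r i) k - minn (h r i.+1) k) =
           boxes i m.+1)%N.
  apply: eq_big_nat => -[//|r] /andP[mr _].
  have := h_strip r i; have := h_decr r.+1 i; have := @h_rows m r i.+1 mr.
  lia.
have Lm := boxes_lattice m i; have dm := h_decr m i.
have bm : boxes i m = (h m i - h m i.+1 + boxes i m.+1)%N.
  by rewrite /boxes big_ltn.
case: m hmk m_min mN bm Lm dm {head tail} => [|q] hmk m_min mN bm Lm dm.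
  by move: hmk Lm; lia.
(* If [h m i] exceeds [k], the row condition at [m] and the strip condition suffice; otherwise all
   entries [i.+1] of row [m] count, and the row condition at [q], the row above, applies. *)
have Lq := boxes_lattice q i.
have bq : boxes i.+1 q = (h q i.+1 - h q i.+2 + boxes i.+1 q.+1)%N.
  by rewrite /boxes big_ltn // ltnW.
have kq : (k < h q i.+1)%N.
  by rewrite ltnNge; apply/negP => /m_min; rewrite ltnn.
move: hmk Lm dm (h_strip q i) (h_decr q i.+1) kq Lq bq bm; lia.
Qed.

Lemma tableau_of_rows : exists T, socle_tableau alp bet gam T.
Proof.
exists T; split=> //.
- move=> j; case: (leqP (nth 0 gam j) (nth 0 bet j)) => // lt_bg.
  have := h_le (nth 0 bet j) (leq0n s); rewrite h_start h_end //.
  rewrite leqNgt => /negP[]; apply: leq_ltn_trans (_ : j < _)%N.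
    by rewrite leqNgt transpose_part_gt // ltnn.
  by rewrite transpose_part_gt.
- move=> r j; rewrite in_skewE => /andP[hsj jh0].
  by rewrite ltnNge T_le // -ltnNge.
- case=> // i _; rewrite entries_leftE -boxes_content /boxes big_mkord.
  apply: eq_bigr => r _.
  have hsz k : (h r k <= size bet)%N.
    by rewrite (leq_trans (h_le r (leq0n k))) // h_start count_size.
  by rewrite !(minn_idPl _).
- move=> r i j; rewrite !in_skewE => /andP[hsi _] /andP[hsj _] ij.
  rewrite T_le // (leq_trans _ (ltnW ij)) //.
  by rewrite -T_le.
- move=> r q j; rewrite !in_skewE => /andP[hrj jhr] /andP[hqj jhq] rq.
  have : (h r (T r j) <= j)%N by rewrite -T_le.
  case: (T r j) => [|t] hrt; first by rewrite ltnNge hrt in jhr.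
  rewrite ltnS T_le // (leq_trans _ hrt) //.
  case: q rq hqj jhq => // q rq _ _.
  by apply: leq_trans (h_strip q t) _; apply: h_rows.
- by move=> k [//|i] _; rewrite !entries_leftE; apply: boxes_left_lattice.
Qed.

End TableauOfRows.

(** * From exact sequences to tableaux *)

Lemma scale_linear (R : comNzRingType) (M : lmodType R) (a : R) :
  linear (fun x : M => a *: x).
Proof. by move=> b x y; rewrite scalerDr !scalerA mulrC. Qed.

Definition scaling (R : comNzRingType) (M : lmodType R) (a : R) :
  {linear M -> M} := Linear_of (scale_linear a).

Lemma sum_nth (lam : seq nat) (F : nat -> nat) :
  (\sum_(j < size lam) F (nth 0 lam j) = \sum_(l <- lam) F l)%N.
Proof. by rewrite (big_nth 0%N) big_mkord. Qed.

Lemma sum_nth_gt (lam : seq nat) i :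
  (\sum_(j < size lam) (i < nth 0 lam j) = transpose_part lam i.+1)%N.
Proof.
rewrite (sum_nth lam (fun l => nat_of_bool (i < l)%N)) /transpose_part.
by rewrite -sum1_count [RHS]big_mkcond; apply: eq_bigr => l _; case: (_ < _)%N.
Qed.

(** The sum on the left counts the boxes in the rows from [i] on, and row [i] has
    [transpose_part lam i.+1] boxes. *)
Lemma sum_nth_subn (lam : seq nat) i :
  (\sum_(j < size lam) (nth 0 lam j - i) =
   \sum_(j < size lam) (nth 0 lam j - i.+1) + transpose_part lam i.+1)%N.
Proof.
by rewrite -sum_nth_gt -big_split; apply: eq_bigr => j _ /=; case: ltnP; lia.
Qed.

Lemma sum_nth_minn (lam : seq nat) i :
  (\sum_(j < size lam) minn (nth 0 lam j) i.+1 =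
   \sum_(j < size lam) minn (nth 0 lam j) i + transpose_part lam i.+1)%N.
Proof.
by rewrite -sum_nth_gt -big_split; apply: eq_bigr => j _ /=; case: ltnP; lia.
Qed.

Lemma nth_le_sumn (lam : seq nat) j : (nth 0 lam j <= sumn lam)%N.
Proof.
elim: lam j => [|l lam IH] [|j] //=; first exact: leq_addr.
exact: leq_trans (IH j) (leq_addl _ _).
Qed.

Lemma sum_nat_telescope (D : nat -> nat) m N :
  (forall r, D r.+1 <= D r)%N -> (forall r, N <= r -> D r = 0)%N ->
  (\sum_(m <= r < N) (D r - D r.+1) = D m)%N.
Proof.
move=> Ddecr D0; have [k] : exists k, (N <= m + k)%N by exists N; apply: leq_addl.
elim: k m => [|k IH] m; first by rewrite addn0 => Nm; rewrite big_geq ?D0.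
rewrite -addSnnS => /IH {}IH; have [Nm|mN] := leqP N m.
  by rewrite big_geq ?D0.
by rewrite big_ltn // IH subnK.
Qed.

(** * Lengths of multiples and torsion in coordinates *)

Section Lengths.
Variables (R : idomainType) (p : R).
Hypothesis unit_or_multiple :
  forall x : R, x \is a GRing.unit \/ exists y, x = y * p.
Hypothesis p_neq0 : p != 0.
Hypothesis p_nonunit : p \isn't a GRing.unit.
Variables (M : lmodType R) (n : nat) (b : nat -> nat).
Variable phi : {linear 'rV[R]_n -> M}.
Hypothesis phi_coord : coordinates p b phi.

Lemma has_length_module : has_length p [set: M] (\sum_(j < n) b j).
Proof.
have [phi_surj phi_ker] := phi_coord.
have := length_lattice p_neq0 p_nonunit phi_ker (c := fun=> 0%N).
have -> : (\sum_(j < n) (b j - 0) = \sum_(j < n) b j)%N.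
  by apply: eq_bigr => j _; rewrite subn0.
suff -> : phi @` lattice p (fun=> 0%N) = [set: M] by apply.
apply/seteqP; split=> // m _; have [x <-] := phi_surj m.
by exists x => // j; apply: pdvd_all.
Qed.

(** The multiples by [p ^+ m] are the image of the lattice with exponents [minn m (b j)]. *)
Lemma length_multiples m :
  length p (range (scaling M (p ^+ m))) = (\sum_(j < n) (b j - m))%N.
Proof.
have [phi_surj phi_ker] := phi_coord.
have := length_lattice p_neq0 p_nonunit phi_ker (c := fun j => minn m (b j)).
move=> /(_ (fun j => geq_minr m (b j))) /(lengthE unit_or_multiple).
have -> : (\sum_(j < n) (b j - minn m (b j)) = \sum_(j < n) (b j - m))%N.
  by apply: eq_bigr => j _; lia.
move=> <-; congr (length p _); apply/seteqP; split.
  move=> _ [y _ <-] /=; have [x <-] := phi_surj y; exists (p ^+ m *: x).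
    move=> j; rewrite mxE mulrC; apply: pdvdM.
    exact: pdvd_leq (geq_minl _ _) (pdvdX _ _).
  by rewrite linearZ.
move=> _ [x xL <-]; have [c cE] := choice xL.
exists (phi (\row_j if (m <= b j)%N then c j else 0)) => //=.
rewrite -linearZ; apply/subr0_eq; rewrite -linearB; apply/phi_ker => j.
rewrite !mxE cE; case: leqP => mb.
  by rewrite mulrC subrr; apply: pdvd0.
by rewrite mulr0 sub0r; apply: pdvdN; exists (c j).
Qed.

(** The elements killed by [p ^+ i] are the image of the lattice with exponents [b j - i]. *)
Lemma length_torsion i :
  length p [set x : M | p ^+ i *: x = 0] = (\sum_(j < n) minn (b j) i)%N.
Proof.
have [phi_surj phi_ker] := phi_coord.
have := length_lattice p_neq0 p_nonunit phi_ker (c := fun j => (b j - i)%N).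
move=> /(_ (fun j => leq_subr i (b j))) /(lengthE unit_or_multiple).
have -> : (\sum_(j < n) (b j - (b j - i)) = \sum_(j < n) minn (b j) i)%N.
  by apply: eq_bigr => j _; lia.
move=> <-; congr (length p _); apply/seteqP; split.
  move=> y /=; have [x <-] := phi_surj y; rewrite -linearZ => /phi_ker.
  by move=> /(lattice_scale p_neq0) xL; exists x.
move=> _ [x /(lattice_scale p_neq0) /phi_ker xL <-] /=.
by rewrite -linearZ.
Qed.

Lemma module_killed i :
  (forall j : 'I_n, b j <= i)%N -> forall x : M, p ^+ i *: x = 0.
Proof.
have [phi_surj phi_ker] := phi_coord.
move=> bi y; have [x <-] := phi_surj y; rewrite -linearZ; apply/phi_ker.
apply/(lattice_scale p_neq0) => j.
have -> : (b j - i = 0)%N by apply/eqP; rewrite subn_eq0.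
exact: pdvd_all.
Qed.

End Lengths.

(** * Lengths in the socle filtration of A *)

Section Necessity.
Variables (R : idomainType) (p : R).
Hypothesis unit_or_multiple :
  forall x : R, x \is a GRing.unit \/ exists y, x = y * p.
Hypothesis p_neq0 : p != 0.
Hypothesis p_nonunit : p \isn't a GRing.unit.
Variables (alp bet gam : seq nat).
Hypotheses (bet_part : is_partition bet) (gam_part : is_partition gam).
Variables (A B C : lmodType R) (f : {linear A -> B}) (g : {linear B -> C}).
Hypothesis fg_exact : short_exact f g.
Variables (phiA : {linear 'rV[R]_(size alp) -> A})
  (phiB : {linear 'rV[R]_(size bet) -> B})
  (phiC : {linear 'rV[R]_(size gam) -> C}).
Hypothesis coordA : coordinates p (nth 0%N alp) phiA.
Hypothesis coordB : coordinates p (nth 0%N bet) phiB.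
Hypothesis coordC : coordinates p (nth 0%N gam) phiC.

Let scal m : {linear B -> B} := scaling B (p ^+ m).

Let modS_linear i : linear (fun b : B => (g b, p ^+ i *: b) : (C * B)%type).
Proof.
by move=> a x y; rewrite linearP; congr (_, _); apply: scale_linear.
Qed.

(* Its kernel is the [i]-th socle of A, so its image is B / soc^i A. *)
Let modS i : {linear B -> (C * B)%type} := Linear_of (modS_linear i).

Let P m : set B := range (scal m).
Let S i : set B := [set b | modS i b = 0].

Let SE i b : S i b <-> g b = 0 /\ p ^+ i *: b = 0.
Proof. by split=> [[]|[gb pb]] //; rewrite /S /= gb pb. Qed.

Let finB : finite_length p [set: B].
Proof. by eexists; apply: has_length_module coordB. Qed.

Let sP m : submod (P m).
Proof. exact/submod_image/submodT. Qed.

Let sS i : submod (S i).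
Proof. exact: submod_ker. Qed.

Let fin (X : set B) : submod X -> finite_length p X.
Proof. by move=> sX; apply: finite_length_subset finB sX _. Qed.

Let P_decr m : P m.+1 `<=` P m.
Proof.
move=> _ [x _ <-]; exists (p *: x) => //=.
by rewrite scalerA -exprSr.
Qed.

(** [H m i] is the length of p^m (B / soc^i A), [L m i] that of the part of soc^i A divisible by p^m
    in B. Since p^i has kernel soc^i A on soc^(i+1) A, [D m i] is the increment of [L m] from [i] to
    [i.+1]; it will count the entries [i.+1] in the rows from [m] on. *)
Let D m i := length p (scal i @` (P m `&` S i.+1)).
Let H m i := length p (modS i @` P m).
Let L m i := length p (P m `&` S i).

Let PE m i : length p (P m) = (L m i + H m i)%N.
Proof. exact: length_ker_image (fin (sP m)). Qed.

Let LE m i : L m i.+1 = (L m i + D m i)%N.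
Proof.
rewrite {1}/L (length_ker_image unit_or_multiple (scal i)); last first.
  exact/fin/submodI.
congr (length p _ + _)%N; apply/seteqP; split=> x [].
  by move=> [Px /SE [gx _]] /= pix; split=> //; apply/SE.
move=> Px /SE [gx pix]; do 2!split=> //; apply/SE; split=> //.
by rewrite exprS -scalerA pix scaler0.
Qed.

Let H_decr m i : (H m.+1 i <= H m i)%N.
Proof.
apply: length_subset => //; first exact/finite_length_image/fin.
  exact/submod_image.
exact/image_subset.
Qed.

Let D_decr m i : (D m.+1 i <= D m i)%N.
Proof.
apply: length_subset => //; first exact/finite_length_image/fin/submodI.
  exact/submod_image/submodI.
by apply/image_subset => x [/P_decr].
Qed.

(** As p^(i+1) x = p^i (p x), and multiplication by [p] raises divisibility by one while lowering
    the socle index by one, the first image is contained in the second. *)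
Let D_lattice m i : (D m i.+1 <= D m.+1 i)%N.
Proof.
apply: length_subset => //; first exact/finite_length_image/fin/submodI.
  exact/submod_image/submodI.
move=> _ [x [[y _ <-] /SE [gx px]] <-] /=.
exists (p *: (p ^+ m *: y)); last by rewrite /= [LHS]scalerA -exprSr.
split; first by exists y => //=; rewrite scalerA -exprS.
by apply/SE; split; [rewrite linearZ /= gx scaler0|rewrite [LHS]scalerA -exprSr].
Qed.

Let HD m i : H m i = (H m i.+1 + D m i)%N.
Proof. by have := PE m i; have := PE m i.+1; rewrite LE; lia. Qed.

Let Q m i := length p (modS i.+1 @` (P m `&` [set b | modS i (scal 1 b) = 0])).

Let Q_decr m i : (Q m.+1 i <= Q m i)%N.
Proof.
have sK : submod [set b | modS i (scal 1 b) = 0].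
  exact: (submod_ker (modS i \o scal 1)).
apply: length_subset => //; first exact/finite_length_image/fin/submodI.
  exact/submod_image/submodI.
by apply/image_subset => x [/P_decr].
Qed.

(* Multiplication by p induces a surjection from p^m (B / soc^(i+1) A) onto
   p^(m+1) (B / soc^i A), whose kernel shrinks as m grows. *)
Let HQ m i : H m i.+1 = (H m.+1 i + Q m i)%N.
Proof.
have finP := fin (sP m).
have sK : submod [set b | modS i (scal 1 b) = 0].
  exact: (submod_ker (modS i \o scal 1)).
have := length_ker_image unit_or_multiple (modS i \o scal 1 : {linear _ -> _}) finP.
have -> : (modS i \o scal 1) @` P m = modS i @` P m.+1.
  have scalE x : scal 1 (scal m x) = scal m.+1 x.
    by rewrite /= scalerA expr1 -exprS.
  apply/seteqP; split=> [_ [_ [x _ <-] <-]|_ [_ [x _ <-] <-]].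
    by exists (scal m.+1 x); [exists x|rewrite -scalE].
  by exists (scal m x); [exists x|rewrite -scalE].
have := length_ker_image unit_or_multiple (modS i.+1) (fin (submodI (sP m) sK)).
have -> : P m `&` [set b | modS i (scal 1 b) = 0] `&` [set x | modS i.+1 x = 0] =
          P m `&` S i.+1.
  apply/seteqP; split=> x; first by case=> -[].
  move=> [Px Sx]; do 2!split=> //; have /SE [gx px] := Sx.
  apply/SE; rewrite /= expr1; split; first by rewrite linearZ /= gx scaler0.
  by rewrite scalerA -exprSr.
rewrite -/(Q m i) -/(L m i.+1) -/(H m.+1 i) => E1 E2.
have := PE m i.+1; rewrite E2 /= E1; lia.
Qed.

Let H_start m : H m 0 = (\sum_(j < size bet) (nth 0 bet j - m))%N.
Proof.
rewrite -(length_multiples unit_or_multiple p_neq0 p_nonunit coordB m) (PE m 0).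
suff -> : L m 0 = 0%N by [].
apply: (lengthE unit_or_multiple); suff -> : P m `&` S 0 = [set (0 : B)].
  by constructor.
apply/seteqP; split=> [x [_ /SE [_]]|x /= ->]; first by rewrite scale1r.
by split; apply: submod0.
Qed.

(** [sumn alp] bounds all parts of [alp], so [p ^+ i] kills A. *)
Let ker_S i : (sumn alp <= i)%N -> S i = [set b | g b = 0].
Proof.
move=> si; apply/seteqP; split=> b; first by case/SE.
move=> /= gb; apply/SE; split=> //; have [_ exB _] := fg_exact.
have [a <-] := (exB b).1 gb; rewrite -linearZ.
rewrite (module_killed p_neq0 coordA) ?linear0 // => j.
exact: leq_trans (nth_le_sumn _ _) si.
Qed.

Let H_end m i : (sumn alp <= i)%N ->
  H m i = (\sum_(j < size gam) (nth 0 gam j - m))%N.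
Proof.
move=> si; rewrite -(length_multiples unit_or_multiple p_neq0 p_nonunit coordC m).
have := length_ker_image unit_or_multiple g (fin (sP m)).
have := PE m i; rewrite /L ker_S // => ->.
move=> /addnI ->; congr (length p _); apply/seteqP; split.
  by move=> _ [_ [x _ <-] <-]; exists (g x) => //=; rewrite linearZ.
move=> _ [c _ <-]; have [_ _ gsurj] := fg_exact; have [b <-] := gsurj c.
by exists (p ^+ m *: b); [exists b|rewrite /= linearZ].
Qed.

Let L_start i : L 0 i = (\sum_(j < size alp) minn (nth 0 alp j) i)%N.
Proof.
rewrite -(length_torsion unit_or_multiple p_neq0 p_nonunit coordA i).
have [finj exB _] := fg_exact.
have finA : finite_length p [set x : A | p ^+ i *: x = 0].
  have finA : finite_length p [set: A] by eexists; apply: has_length_module coordA.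
  by apply: finite_length_subset finA (submod_ker (scaling A (p ^+ i))) _.
rewrite -(length_image_inj unit_or_multiple finA finj); congr (length p _).
apply/seteqP; split=> b.
  move=> [_ /SE [/exB [a <-]]]; rewrite -linearZ -[X in _ = X](linear0 f).
  by move=> /finj pa; exists a.
move=> [a /= pa <-]; split; first by exists (f a) => //=; rewrite scale1r.
by apply/SE; split; [apply/exB; exists a|rewrite -linearZ pa linear0].
Qed.

Lemma exact_tableau : exists T, socle_tableau alp bet gam T.
Proof.
(* [h r i] is the length of p^r M / p^(r+1) M for M = B / soc^i A, the number of its cyclic summands
   of length greater than [r]; [N] exceeds every part of [bet]. *)
pose N := (sumn bet).+1; pose h r i := (H r i - H r.+1 i)%N.
have betN j : (nth 0 bet j < N)%N by rewrite ltnS nth_le_sumn.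
have D0 i r : (N <= r)%N -> D r i = 0%N.
  move=> Nr; suff P0 : length p (P r) = 0%N.
    by have := PE r i.+1; rewrite P0 LE; lia.
  rewrite (length_multiples unit_or_multiple p_neq0 p_nonunit coordB).
  apply: big1 => j _; apply/eqP; rewrite subn_eq0.
  exact: leq_trans (ltnW (betN j)) Nr.
have hD r i : (h r i - h r i.+1 = D r i - D r.+1 i)%N.
  have := HD r i; have := HD r.+1 i; have := H_decr r i.
  by have := H_decr r i.+1; have := D_decr r i; rewrite /h; lia.
have boxesE i m : (\sum_(m <= r < N) (h r i - h r i.+1) = D m i)%N.
  under eq_bigr do rewrite hD.
  exact: sum_nat_telescope (fun r => D_decr r i) (D0 i).
apply: (@tableau_of_rows alp bet gam h (sumn alp) N) => //.
- have := length_ker_image unit_or_multiple g finB.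
  have -> : [set: B] `&` [set x | g x = 0] = P 0 `&` S (sumn alp).
    rewrite ker_S //; apply/seteqP; split=> x [_ gx]; split=> //.
    by exists x => //=; rewrite scale1r.
  have -> : g @` [set: B] = [set: C].
    apply/seteqP; split=> // c _; have [_ _ gsurj] := fg_exact.
    by have [b <-] := gsurj c; exists b.
  rewrite (lengthE unit_or_multiple (has_length_module p_neq0 p_nonunit coordB)).
  rewrite (lengthE unit_or_multiple (has_length_module p_neq0 p_nonunit coordC)).
  rewrite -/(L 0 (sumn alp)) L_start.
  have nthE lam : (\sum_(j < size lam) nth 0 lam j = sumn lam)%N.
    by rewrite (sum_nth lam id) sumnE.
  rewrite !nthE => ->; congr (_ + _)%N; rewrite -[LHS]nthE.
  by apply: eq_bigr => j _; apply/esym/minn_idPl/nth_le_sumn.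
- by move=> r; rewrite /h !H_start sum_nth_subn addKn.
- by move=> r i si; rewrite /h !H_end // sum_nth_subn addKn.
- move=> r i; rewrite /h.
  have := HD r i; have := HD r.+1 i; have := H_decr r i.
  by have := H_decr r i.+1; have := D_decr r i; lia.
(* By [HQ], the difference of [h r i.+1] and [h r.+1 i] is that of [Q r i] and [Q r.+1 i]. *)
- move=> r i; rewrite /h !HQ.
  by have := Q_decr r i; have := H_decr r.+1 i; lia.
- by move=> m i; rewrite !boxesE.
move=> i; rewrite boxesE; have := LE 0 i; rewrite !L_start sum_nth_minn.
by move/addnI.
Qed.

End Necessity.

(** * From tableaux to exact sequences *)

Lemma is_partition_inj (lam mu : seq nat) :
  is_partition lam -> is_partition mu ->
  (forall i, transpose_part lam i.+1 = transpose_part mu i.+1) -> lam = mu.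
Proof.
move=> lamP muP tE.
have nth_le nu nu' j : is_partition nu -> is_partition nu' ->
    (forall i, transpose_part nu i.+1 = transpose_part nu' i.+1) ->
    (nth 0 nu j <= nth 0 nu' j)%N.
  move=> nuP nu'P E; rewrite leqNgt; apply/negP.
  by rewrite -transpose_part_gt // E transpose_part_gt // ltnn.
have nthE j : nth 0%N lam j = nth 0%N mu j.
  by apply/eqP; rewrite eqn_leq !nth_le.
apply: (@eq_from_nth _ 0%N) => //.
have sizeE nu : is_partition nu -> size nu = transpose_part nu 1.
  by case/andP=> _ pos; apply/esym/eqP; rewrite -all_count.
by rewrite !sizeE.
Qed.

Lemma partition_nth_leq (lam : seq nat) j k : is_partition lam ->
  (j <= k)%N -> (nth 0 lam k <= nth 0 lam j)%N.
Proof.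
move=> lamP jk; rewrite leqNgt; apply/negP => lt_jk.
have := lt_jk; rewrite -transpose_part_gt // ltnNge => /negP[].
apply: leq_trans jk; rewrite leqNgt.
by rewrite transpose_part_gt // ltnn.
Qed.

(* The [k]-th element of [P] is sent to the [k]-th element of [Q]. *)
Lemma ordered_matching (P Q : nat -> bool) :
  (forall j, P j -> ~~ Q j) ->
  (forall k, \sum_(j < k) P j <= \sum_(j < k) Q j)%N ->
  exists s : nat -> nat, [/\ forall j, P j -> Q (s j), forall j, P j -> (s j < j)%N
    & forall j k, P j -> P k -> s j = s k -> j = k].
Proof.
move=> PQ leq_PQ; pose c (S : nat -> bool) k := (\sum_(j < k) S j)%N.
pose q k := filter Q (iota 0 k).
have size_q k : size (q k) = c Q k.
  elim: k => [|k IH]; first by rewrite /c big_ord0.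
  rewrite /q -addn1 iotaD filter_cat size_cat -/(q k) IH add0n /= /c addn1.
  by rewrite big_ord_recr /=; case: (Q k).
have c_lt j k : P j -> (j < k)%N -> (c P j < c P k)%N.
  move=> Pj; elim: k => // k IH; rewrite ltnS leq_eqVlt /c big_ord_recr /=.
  case/orP=> [/eqP <-|/IH /leq_trans]; first by rewrite Pj addn1.
  by apply; apply: leq_addr.
(* Since [j] is in [P] and not in [Q], the counting hypothesis at [j.+1] provides more than [c P j]
   elements of [Q] strictly below [j]. *)
have index_ok j : P j -> (c P j < size (q j))%N.
  move=> Pj; rewrite size_q; apply: leq_trans (c_lt j j.+1 Pj (ltnSn j)) _.
  apply: leq_trans (leq_PQ _) _.
  by rewrite big_ord_recr /= (negbTE (PQ j Pj)) addn0.
pose s j := nth 0%N (q j) (c P j).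
have s_mem j : P j -> s j \in q j by move=> Pj; rewrite mem_nth // index_ok.
have s_eq j k : P j -> (j <= k)%N -> s j = nth 0%N (q k) (c P j).
  move=> Pj jk; rewrite /q -(subnKC jk) iotaD filter_cat -/(q j).
  by rewrite nth_cat index_ok.
have s_inj j k : P j -> P k -> (j < k)%N -> s j <> s k.
  move=> Pj Pk jk; rewrite (s_eq j k Pj (ltnW jk)) => /eqP.
  have ltjk := c_lt j k Pj jk.
  rewrite nth_uniq ?index_ok ?filter_uniq ?iota_uniq //.
    by rewrite ltn_eqF.
  exact: ltn_trans ltjk (index_ok k Pk).
exists s; split=> [j /s_mem|j /s_mem|j k Pj Pk sjk].
- by rewrite mem_filter => /andP[].
- by rewrite mem_filter mem_iota => /andP[].
case: (ltngtP j k) => // [/(s_inj j k Pj Pk)|/(s_inj k j Pk Pj)] //.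
by move/nesym.
Qed.

Lemma sum_nat_lt_const a b c : (a <= c <= b)%N ->
  (\sum_(a <= q < b) (q < c) = c - a)%N.
Proof.
move=> /andP[ac cb]; rewrite (big_cat_nat ac cb) /=.
rewrite [X in (_ + X)%N]big_nat_cond [X in (_ + X)%N]big1 ?addn0; last first.
  by move=> q /andP[/andP[cq _] _]; rewrite ltnNge cq.
rewrite (eq_big_nat _ _ (F2 := fun=> 1%N)) ?sum_nat_const_nat ?muln1 //.
by move=> q /andP[_ ->].
Qed.

(** * The chain of partitions of a tableau *)

Section TableauChain.
Variables (alp bet gam : seq nat) (T : nat -> nat -> nat).
Hypotheses (bet_part : is_partition bet) (gam_part : is_partition gam).
Hypothesis T_tab : socle_tableau alp bet gam T.

(** The length of column [j] in the [i]-th partition of the chain, made of [gam] and the boxes with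
    entries greater than [i]. *)
Definition chain_part i j : nat :=
  (nth 0 gam j + \sum_(nth 0 gam j <= r < nth 0 bet j) (i < T r j))%N.

Definition has_label l j : bool :=
  (0 < \sum_(nth 0 gam j <= r < nth 0 bet j) (T r j == l))%N.

Lemma label_le r j : is_partition alp -> in_skew bet gam r j ->
  (T r j <= sumn alp)%N.
Proof.
move=> alp_part rj; have := st_positive T_tab rj; case El : (T r j) => [//|l] _.
apply: leq_trans (nth_le_sumn alp 0).
rewrite -transpose_part_gt // -(st_content T_tab (isT : (1 <= l.+1)%N)).
have jb : (j < size bet)%N.
  rewrite ltnNge; apply/negP => jb; move: rj; rewrite /in_skew.
  by rewrite (nth_default _ jb) ltn0 andbF.
rewrite /entries_left (bigD1 (Ordinal jb)) //= addn_gt0; apply/orP; left.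
rewrite (bigD1_seq r) ?iota_uniq ?mem_index_iota //=.
by rewrite El eqxx.
Qed.

Lemma chain_part_end i j : is_partition alp -> (sumn alp <= i)%N ->
  chain_part i j = nth 0%N gam j.
Proof.
move=> alp_part si; rewrite /chain_part big_nat_cond big1 ?addn0 // => r.
rewrite andbT => rj; rewrite ltnNge (leq_trans _ si) //.
exact: label_le.
Qed.

Lemma chain_part0 j : chain_part 0 j = nth 0%N bet j.
Proof.
rewrite /chain_part (eq_big_nat _ _ (F2 := fun=> 1%N)).
  by rewrite sum_nat_const_nat muln1 subnKC ?(st_contained T_tab).
by move=> r rj; rewrite (st_positive T_tab rj).
Qed.

Lemma column_label_le1 l j :
  (\sum_(nth 0 gam j <= r < nth 0 bet j) (T r j == l) <= 1)%N.
Proof.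
case: (pselect (exists2 r, in_skew bet gam r j & T r j = l)) => [[r rj rl]|h].
  rewrite (bigD1_seq r) ?iota_uniq ?mem_index_iota //= rl eqxx.
  rewrite big_nat_cond big1 // => q /andP[qj qr]; apply/eqP; rewrite eqb0.
  apply/eqP => ql; move: qr; rewrite neq_ltn => /orP[] lt_rq.
    by have := st_columns T_tab qj rj lt_rq; rewrite rl ql ltnn.
  by have := st_columns T_tab rj qj lt_rq; rewrite rl ql ltnn.
rewrite big_nat_cond big1 // => r; rewrite andbT => rj.
by apply/eqP; rewrite eqb0; apply/eqP => rl; apply: h; exists r.
Qed.

Lemma has_labelE l j :
  (\sum_(nth 0 gam j <= r < nth 0 bet j) (T r j == l))%N = has_label l j.
Proof.
rewrite /has_label; have := column_label_le1 l j.
by case: (\sum_(_ <= _ < _) _)%N => [|[]].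
Qed.

Lemma chain_partS i j : chain_part i j = (chain_part i.+1 j + has_label i.+1 j)%N.
Proof.
rewrite -has_labelE /chain_part -addnA -big_split; congr (_ + _)%N.
apply: eq_bigr => r _ /=; rewrite [in LHS]leq_eqVlt eq_sym.
by case: eqP => [->|_]; rewrite ?ltnn ?addn0.
Qed.

Lemma has_label_lattice i k :
  (\sum_(j < k) has_label i.+2 j <= \sum_(j < k) has_label i.+1 j)%N.
Proof.
have := st_lattice T_tab k (isT : (1 <= i.+1)%N); rewrite /entries_left.
under eq_bigr do rewrite has_labelE.
by under [X in (_ <= X)%N -> _]eq_bigr do rewrite has_labelE.
Qed.

Lemma has_label_content i :
  (\sum_(j < size bet) has_label i.+1 j = transpose_part alp i.+1)%N.
Proof.
rewrite -(st_content T_tab (isT : (1 <= i.+1)%N)).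
by apply: eq_bigr => j _; rewrite has_labelE.
Qed.

(** Entries strictly decrease down a column, so those greater than [i] are the topmost ones and
    directly continue the column of [gam]. *)
Lemma lt_chain_part i r j : in_skew bet gam r j ->
  (r < chain_part i j)%N = (i < T r j)%N.
Proof.
move=> rj; have /andP[gr rb] := rj.
have [iT|Ti] := ltnP i (T r j).
  suff : (r.+1 - nth 0 gam j <=
      \sum_(nth 0 gam j <= q < nth 0 bet j) (i < T q j))%N.
    by rewrite /chain_part; lia.
  rewrite -(@sum_nat_lt_const (nth 0 gam j) (nth 0 bet j) r.+1); last first.
    by rewrite rb (leq_trans gr (leqnSn r)).
  rewrite big_nat_cond [X in (_ <= X)%N]big_nat_cond; apply: leq_sum => q.
  rewrite andbT => qj; rewrite ltnS; case: (ltngtP q r) => // [qr|->].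
    by rewrite (ltn_trans iT) // (st_columns T_tab qj rj qr).
  by rewrite iT.
apply/negbTE; rewrite -leqNgt.
suff : (\sum_(nth 0 gam j <= q < nth 0 bet j) (i < T q j) <= r - nth 0 gam j)%N.
  by rewrite /chain_part; lia.
rewrite -(@sum_nat_lt_const (nth 0 gam j) (nth 0 bet j) r); last by rewrite gr ltnW.
rewrite big_nat_cond [X in (_ <= X)%N]big_nat_cond; apply: leq_sum => q.
rewrite andbT => qj; case: (ltngtP q r) => [_|rq|->].
- exact: leq_b1.
- rewrite [(i < _)%N]ltnNge (leq_trans _ Ti) //.
  by rewrite ltnW // (st_columns T_tab rj qj rq).
by rewrite [(i < _)%N]ltnNge Ti.
Qed.

(** Otherwise the box in row [chain_part i j] lies in the skew diagram in both columns, with an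
    entry at most [i] in column [j] and a larger one in column [k], against (ST-1). *)
Lemma chain_part_leq i j k : (j <= k)%N -> (chain_part i k <= chain_part i j)%N.
Proof.
rewrite leq_eqVlt => /orP[/eqP -> //|jk]; rewrite leqNgt; apply/negP => lt_kj.
have le_bet l : (chain_part i l <= nth 0 bet l)%N.
  rewrite -chain_part0; rewrite leq_add2l; apply: leq_sum => r _.
  by case: ltnP => // /(leq_ltn_trans (leq0n i)) ->.
have gj : (nth 0 gam j <= chain_part i j)%N by apply: leq_addr.
have rk : in_skew bet gam (chain_part i j) k.
  rewrite /in_skew (leq_trans lt_kj (le_bet k)) andbT.
  exact: leq_trans (partition_nth_leq gam_part (ltnW jk)) gj.
have rj : in_skew bet gam (chain_part i j) j.
  rewrite /in_skew gj (leq_trans lt_kj) //.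
  exact: leq_trans (le_bet k) (partition_nth_leq bet_part (ltnW jk)).
have := lt_chain_part i rj; rewrite ltnn => /esym; rewrite ltnNge => /negbFE Tj.
move: lt_kj; rewrite lt_chain_part // ltnNge.
by rewrite (leq_trans (st_rows T_tab rj rk jk) Tj).
Qed.

(** Columns with both entries [i.+1] and [i.+2] contribute equally to the two sides of the lattice
    condition; cancelling them leaves the counting hypothesis of [ordered_matching]. *)
Lemma chain_matching i : exists s : nat -> nat,
  [/\ forall j, has_label i.+2 j && ~~ has_label i.+1 j ->
        has_label i.+1 (s j) && ~~ has_label i.+2 (s j),
      forall j, has_label i.+2 j && ~~ has_label i.+1 j -> (s j < j)%N
    & forall j k, has_label i.+2 j && ~~ has_label i.+1 j ->
        has_label i.+2 k && ~~ has_label i.+1 k -> s j = s k -> j = k].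
Proof.
apply: (@ordered_matching (fun j => has_label i.+2 j && ~~ has_label i.+1 j)
                          (fun j => has_label i.+1 j && ~~ has_label i.+2 j)).
  by move=> j /andP[-> _]; rewrite andbF.
move=> k; have := has_label_lattice i k.
have splitE (S S' : nat -> bool) : (\sum_(j < k) S j =
    \sum_(j < k) (S j && ~~ S' j) + \sum_(j < k) (S j && S' j))%N.
  by rewrite -big_split; apply: eq_bigr => j _ /=; case: (S j); case: (S' j).
rewrite (splitE (has_label i.+2) (has_label i.+1)).
rewrite [X in (_ <= X)%N](splitE (has_label i.+1) (has_label i.+2)).
under [X in (_ <= _ + X)%N]eq_bigr do rewrite andbC.
by rewrite leq_add2r.
Qed.

End TableauChain.

(** * The automorphism attached to two successive strips *)

Section ChangeOfBasis.
Variables (R : idomainType) (p : R).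
Hypothesis p_neq0 : p != 0.
Variables (n : nat) (b b1 b2 : nat -> nat) (J J' : nat -> bool) (s : nat -> nat).
Hypothesis bE : forall j, b j = (b1 j + J j)%N.
Hypothesis b1E : forall j, b1 j = (b2 j + J' j)%N.
Hypothesis b1_decr : forall j k, (j <= k)%N -> (b1 k <= b1 j)%N.
(** In the application [b], [b1], [b2] are the partitions [i], [i.+1], [i.+2] of the chain, [J] and
    [J'] mark the columns containing [i.+1] and [i.+2], and [s] is the matching. *)
Let moved j := J' j && ~~ J j.
Hypothesis s_target : forall j, moved j -> J (s j) && ~~ J' (s j).
Hypothesis s_lt : forall j, moved j -> (s j < j)%N.
Hypothesis s_inj : forall j k, moved j -> moved k -> s j = s k -> j = k.

Let shift : 'M[R]_n := \matrix_(j, k)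
  if moved j && (s j == k) then p ^+ (b1 (s j) - b1 j) else 0.

Let shift_entry (y : 'rV[R]_n) (j k : 'I_n) : moved j -> s j = k ->
  (y *m shift) 0 k = y 0 j * p ^+ (b1 k - b1 j).
Proof.
move=> mj sjk; rewrite !mxE (bigD1 j) //= big1 ?addr0 => [|i ij].
  by rewrite mxE mj sjk eqxx.
rewrite mxE; case: ifP => [/andP[mi /eqP sik]|]; last by rewrite mulr0.
by case/eqP: ij; apply/val_inj/s_inj => //; rewrite sik sjk.
Qed.

Let shift_eq0 (y : 'rV[R]_n) (k : 'I_n) :
  ~~ (J k && ~~ J' k) -> (y *m shift) 0 k = 0.
Proof.
move=> nk; rewrite mxE big1 // => i _; rewrite mxE.
case: ifP => [/andP[mi /eqP sik]|]; last by rewrite mulr0.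
by move: (s_target mi); rewrite sik (negbTE nk).
Qed.

(** Vectors in the image of [shift] are supported on columns in [J], which are not moved. *)
Let shift_shift (y : 'rV[R]_n) : y *m shift *m shift = 0.
Proof.
apply/rowP => k; rewrite [RHS]mxE mxE big1 // => j _; rewrite [shift j k]mxE.
case: ifP => [/andP[mj _]|]; last by rewrite mulr0.
rewrite shift_eq0 ?mul0r //.
by move: mj; rewrite /moved => /andP[-> _]; rewrite andbF.
Qed.

Let lattice_shift (y : 'rV[R]_n) :
  lattice p b1 y -> lattice p b1 (y *m shift).
Proof.
move=> yL k; rewrite mxE; apply: (big_ind (pdvd p (b1 k))) => [|u v|j _].
- exact: pdvd0.
- exact: pdvdD.
rewrite mxE; case: ifP => [/andP[mj /eqP sjk]|_].
  2: by rewrite mulr0; apply: pdvd0.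
have le_b1 : (b1 j <= b1 k)%N by rewrite b1_decr // -sjk ltnW // s_lt.
have [c ->] := yL j; exists c.
by rewrite sjk -mulrA -exprD subnKC.
Qed.

(* The matrix is [1 - shift], where the square-zero matrix [shift] sends the
   basis vector of a moved column [j] to a multiple of that of [s j]. *)
Lemma change_of_basis : exists U : 'M[R]_n,
  [/\ forall x : 'rV[R]_n, lattice p b1 (x *m U) <-> lattice p b1 x,
      forall x : 'rV[R]_n, lattice p b (p *: x) ->
        lattice p b2 (x *m U) -> lattice p b1 x
    & forall y : 'rV[R]_n, exists x, x *m U = y].
Proof.
exists (1%:M - shift).
have UE (x : 'rV[R]_n) : x *m (1%:M - shift) = x - x *m shift.
  by rewrite mulmxBr mulmx1.
have sL := submod_lattice p n b1.
split.
- move=> x; rewrite UE; split=> [zL|xL].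
    (* As [shift] has square zero, [1 + shift] inverts [1 - shift]. *)
    have -> : x = (x - x *m shift) + (x - x *m shift) *m shift.
      by rewrite mulmxBl shift_shift subr0 subrK.
    by apply: (submodD sL) => //; apply: lattice_shift.
  by apply: (submodB sL) => //; apply: lattice_shift.
- move=> y pyL zL k; rewrite UE in zL.
  have in_J (j : 'I_n) : J j -> pdvd p (b1 j) (y 0 j).
    move=> Jj; have := pyL j; rewrite mxE bE Jj -[X in X * _]expr1.
    by rewrite pdvd_mulX.
  have zE (j : 'I_n) : pdvd p (b2 j) (y 0 j - (y *m shift) 0 j).
    by have := zL j; rewrite mxE [X in _ + X]mxE.
  have [Jk|nJk] := boolP (J k); first exact: in_J.
  have yk : y 0 k - (y *m shift) 0 k = y 0 k.
    by rewrite shift_eq0 ?subr0 // negb_and nJk.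
  have [J'k|nJ'k] := boolP (J' k); last first.
    by have := zE k; rewrite yk b1E (negbTE nJ'k) addn0.
  have mk : moved k by rewrite /moved J'k nJk.
  have sk_lt : (s k < n)%N by apply: ltn_trans (s_lt mk) (ltn_ord k).
  pose sk := Ordinal sk_lt; have /andP[Jsk nJ'sk] := s_target mk.
  (* Coordinate [sk] of [y] is divisible by [p ^+ b1 sk] because [J sk] holds, and so is its
     difference from [y 0 k * p ^+ (b1 sk - b1 k)] because [b2] and [b1] agree at [sk]; hence
     [y 0 k] is divisible by [p ^+ b1 k]. *)
  have := zE sk; rewrite (shift_entry (j := k) _ mk) //=.
  have -> : b2 (s k) = b1 (s k) by rewrite b1E (negbTE nJ'sk) addn0.
  move=> zsk; have := pdvdB (in_J sk Jsk) zsk.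
  rewrite opprB addrC subrK mulrC pdvd_mulXsub // subKn //.
  by rewrite b1_decr // ltnW // s_lt.
move=> y; exists (y + y *m shift).
by rewrite UE mulmxDl shift_shift addr0 addrK.
Qed.

End ChangeOfBasis.

(** * The tower of twisted lattices and its socles *)

Section Tower.
Variables (R : idomainType) (p : R).
Hypothesis p_neq0 : p != 0.
Variables (n end_ : nat) (b : nat -> nat -> nat) (J : nat -> nat -> bool)
  (U : nat -> 'M[R]_n).
Hypothesis bS : forall i j, b i j = (b i.+1 j + J i j)%N.
Hypothesis b_end : forall i j, (end_ <= i)%N -> b i j = b end_ j.
Hypothesis U_stable : forall i (x : 'rV[R]_n),
  lattice p (b i.+1) (x *m U i) <-> lattice p (b i.+1) x.
Hypothesis U_socle : forall i (x : 'rV[R]_n), lattice p (b i) (p *: x) ->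
  lattice p (b i.+2) (x *m U i) -> lattice p (b i.+1) x.
Hypothesis U_surj : forall i (y : 'rV[R]_n), exists x, x *m U i = y.

Fixpoint tower_mx i : 'M[R]_n :=
  if i is k.+1 then tower_mx k *m U k else 1%:M.

(** The kernel of the composite of the first [i] twisted quotient maps, from R^n to R^n / p^b(i). *)
Definition tower i : set 'rV[R]_n := [set x | lattice p (b i) (x *m tower_mx i)].

Lemma tower_mxS (x : 'rV[R]_n) i : x *m tower_mx i.+1 = x *m tower_mx i *m U i.
Proof. exact: mulmxA. Qed.

Lemma tower_mx_surj i (y : 'rV[R]_n) : exists x, x *m tower_mx i = y.
Proof.
elim: i y => [|i IH] y; first by exists y; rewrite mulmx1.
have [z zE] := U_surj i y; have [x xE] := IH z.
by exists x; rewrite tower_mxS xE.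
Qed.

(** The last twist preserves the lattice of [b i.+1] and may be dropped. *)
Lemma towerSE i x : tower i.+1 x <-> lattice p (b i.+1) (x *m tower_mx i).
Proof. by rewrite /tower /= mulmxA; apply: U_stable. Qed.

Lemma submod_tower i : submod (tower i).
Proof.
have [L0 LD] := submod_lattice p n (b i).
split=> [|a x y xL yL]; rewrite /tower /= ?mul0mx //.
by rewrite mulmxDl -scalemxAl; apply: LD.
Qed.

Lemma tower_incr i : tower i `<=` tower i.+1.
Proof.
move=> x xL; apply/towerSE; apply: lattice_leq xL => j.
by rewrite [b i j]bS leq_addr.
Qed.

Lemma tower_le i k : (i <= k)%N -> tower i `<=` tower k.
Proof.
elim: k => [|k IH]; first by rewrite leqn0 => /eqP ->.
rewrite leq_eqVlt => /orP[/eqP -> //|]; rewrite ltnS => /IH ik.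
exact: subset_trans ik (@tower_incr k).
Qed.

Lemma tower_sub_end i : tower i `<=` tower end_.
Proof.
have [/tower_le //|] := leqP i end_; elim: i => // i IH.
rewrite ltnS leq_eqVlt => ei; have {IH} IH : tower i `<=` tower end_.
  by case/orP: ei => [/eqP <- //|/IH].
have {}ei : (end_ <= i)%N by case/orP: ei => [/eqP ->|/ltnW].
move=> x /towerSE xL; apply: IH; apply: lattice_leq xL => j.
by rewrite [b i.+1 j]b_end ?leqW // [b i j]b_end.
Qed.

Lemma tower_scale i x : tower i.+1 x -> tower i (p *: x).
Proof.
move=> /towerSE xL; rewrite /tower /= -scalemxAl -[p]expr1.
apply/(lattice_scale p_neq0); apply: lattice_leq xL => j.
by rewrite bS; case: (J i j); lia.
Qed.

(* The socle of [tower end_ / tower i] is [tower i.+1 / tower i]; the lattice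
   condition on tableaux enters through [U_socle]. *)
Lemma tower_socle i x : tower end_ x -> tower i (p *: x) -> tower i.+1 x.
Proof.
move Ek: (end_ - i)%N => k; elim: k i Ek x => [|k IH] i Ek x xend pxi.
  apply: tower_le xend; apply: leqW.
  by rewrite -subn_eq0 Ek.
(* By induction [x] lies in [tower i.+2], which supplies the second hypothesis of [U_socle]. *)
have zL : lattice p (b i.+2) (x *m tower_mx i *m U i).
  rewrite -tower_mxS; apply/towerSE; apply: IH => //; last exact: tower_incr.
  by rewrite subnS Ek.
apply/towerSE; apply: U_socle zL.
by rewrite scalemxAl.
Qed.

Lemma tower_torsion i x : tower end_ x -> tower 0 (p ^+ i *: x) <-> tower i x.
Proof.
elim: i x => [|i IH] x xend; first by rewrite scale1r.
have pxend : tower end_ (p *: x) by apply: submodZ (submod_tower _) xend.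
rewrite exprSr -scalerA IH //; split; [exact: tower_socle|exact: tower_scale].
Qed.

End Tower.

Lemma partition_module_type (R : comNzRingType) (p : R) (lam : seq nat) :
  has_partition_type p (partition_module p lam) lam.
Proof. by exists idfun; exists idfun. Qed.

(** * Construction of the exact sequence *)

Section Sufficiency.
Variables (R : idomainType) (p : R).
Hypothesis unit_or_multiple :
  forall x : R, x \is a GRing.unit \/ exists y, x = y * p.
Hypothesis p_neq0 : p != 0.
Hypothesis p_nonunit : p \isn't a GRing.unit.
Variables (alp bet gam : seq nat) (T : nat -> nat -> nat).
Hypotheses (alp_part : is_partition alp) (bet_part : is_partition bet)
  (gam_part : is_partition gam).
Hypothesis T_tab : socle_tableau alp bet gam T.

Let n := size bet.
Let end_ := sumn alp.
Let b := chain_part bet gam T.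

Lemma tableau_exact : exists (A B C : lmodType R)
    (f : {linear A -> B}) (g : {linear B -> C}),
  [/\ short_exact f g, has_partition_type p A alp,
      has_partition_type p B bet & has_partition_type p C gam].
Proof.
pose J i j := has_label bet gam T i.+1 j.
have bS i j : b i j = (b i.+1 j + J i j)%N by apply: chain_partS T_tab i j.
have b_end i j : (end_ <= i)%N -> b i j = b end_ j.
  by move=> ei; rewrite /b !(chain_part_end T_tab _ alp_part).
have U_ex i : exists U : 'M[R]_n,
  [/\ forall x : 'rV[R]_n, lattice p (b i.+1) (x *m U) <-> lattice p (b i.+1) x,
      forall x : 'rV[R]_n, lattice p (b i) (p *: x) ->
        lattice p (b i.+2) (x *m U) -> lattice p (b i.+1) x
    & forall y : 'rV[R]_n, exists x, x *m U = y].
  have [s [s_target s_lt s_inj]] := chain_matching T_tab i.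
  apply: (change_of_basis p_neq0 n (bS i) (bS i.+1) _ s_target s_lt s_inj).
  by move=> j k; apply: (chain_part_leq bet_part gam_part T_tab).
have [U UP] := choice U_ex.
have U_stable i := let: And3 h _ _ := UP i in h.
have U_socle i := let: And3 _ h _ := UP i in h.
have U_surj i := let: And3 _ _ h := UP i in h.
pose Lam := tower p b U; pose Phi := tower_mx U.
have Lam0 x : Lam 0%N x <-> lattice p (nth 0%N bet) x.
  rewrite /Lam /tower /= mulmx1.
  by split=> xL j; have := xL j; rewrite /b (chain_part0 T_tab).
have Lam_end x : Lam end_ x <-> lattice p (nth 0%N gam) (x *m Phi end_).
  by split=> xL j; have := xL j; rewrite /b (chain_part_end T_tab _ alp_part).
have size_gam : (size gam <= n)%N.
  rewrite leqNgt; apply/negP => lt_n; have := st_contained T_tab n.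
  rewrite [nth 0%N bet n]nth_default // leqn0 => /eqP gn.
  case/andP: gam_part => _ /allP /(_ _ (mem_nth 0%N lt_n)).
  by rewrite gn.
have [phiB [phiB_surj phiB_ker]] :=
  partition_coordinates p (leqnn (size bet) : (size bet <= n)%N).
(* The twisted projection from R^n to R^n / p^b(i) factors through B, because its kernel contains
   [Lam 0]. The case [end_] gives [g]; the other indices serve to compute lengths. *)
have quotient i (N : lmodType R) (c : nat -> nat) (psi : {linear 'rV[R]_n -> N}) :
    coordinates p c psi -> (forall x, Lam i x <-> lattice p c (x *m Phi i)) ->
    exists h : {linear partition_module p bet -> N},
    (forall m, exists y, h y = m) /\ forall x, h (phiB x) = 0 <-> Lam i x.
  move=> [psi_surj psi_ker] LamE.
  have lin : linear (fun x => psi (x *m Phi i)).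
    by move=> a x y; rewrite mulmxDl -scalemxAl linearP.
  have [//||h hE] := @factor_linear _ _ _ _ phiB (Linear_of lin).
    move=> x /phiB_ker /Lam0 xL; apply/psi_ker/LamE.
    exact: tower_le bS U_stable _ _ (leq0n i) _ xL.
  exists h; split=> [m|x].
    have [z zE] := psi_surj m; have [x xE] := tower_mx_surj U_surj i z.
    by exists (phiB x); rewrite hE /= xE.
  by rewrite hE /= psi_ker LamE.
have [phiC phiC_coord] := partition_coordinates p size_gam.
have [g [g_surj g_ker]] := quotient _ _ _ _ phiC_coord Lam_end.
have phiB_coord : coordinates p (nth 0%N bet) phiB by [].
have lenB := has_length_module p_neq0 p_nonunit phiB_coord.
have finB : finite_length p [set: partition_module p bet] by eexists; exact: lenB.
(* The structure theorem gives the kernel of [g] some type [lam], which the lengths of its socles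
   will identify with [alp]. *)
pose A : set (partition_module p bet) := [set y | g y = 0].
have finA : finite_length p A by apply: finite_length_subset finB (submod_ker g) _.
have A_killed x : A x -> p ^+ sumn bet *: x = 0.
  by move=> _; apply: (module_killed p_neq0 phiB_coord) => j; apply: nth_le_sumn.
have [lam lam_part [psi psi_range psi_ker]] :=
  finite_length_coordinates unit_or_multiple p_neq0 finA A_killed.
have socleE i : A `&` [set y | p ^+ i *: y = 0] = phiB @` Lam i.
  apply/seteqP; split.
    move=> y [Ay /= py]; have [x xE] := phiB_surj y; exists x => //.
    have /g_ker xA : g (phiB x) = 0 by rewrite xE.
    apply/(tower_torsion p_neq0 bS U_stable U_socle i xA)/Lam0/phiB_ker.
    by rewrite linearZ /= xE.
  move=> _ [x xL <-]; have xA := tower_sub_end bS b_end U_stable xL.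
  split; first exact/g_ker.
  rewrite /= -linearZ; apply/phiB_ker/Lam0.
  exact/(tower_torsion p_neq0 bS U_stable U_socle i xA).
have len_socle i : length p (A `&` [set y | p ^+ i *: y = 0]) =
    (\sum_(j < size lam) minn (nth 0 lam j) i)%N.
  have := length_lattice p_neq0 p_nonunit psi_ker (c := fun j => (nth 0 lam j - i)%N).
  move=> /(_ (fun j => leq_subr i _)) /(lengthE unit_or_multiple).
  have -> : (\sum_(j < size lam) (nth 0 lam j - (nth 0 lam j - i)) =
             \sum_(j < size lam) minn (nth 0 lam j) i)%N.
    by apply: eq_bigr => j _; lia.
  move=> <-; congr (length p _); rewrite -psi_range; apply/seteqP; split.
    move=> _ [[x _ <-] /=]; rewrite -linearZ => /psi_ker.
    by move=> /(lattice_scale p_neq0) xL; exists x.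
  move=> _ [x /(lattice_scale p_neq0) /psi_ker xL <-].
  by split; [exists x|rewrite /= -linearZ].
(* The [i]-th socle of A is the kernel of B -> R^n / p^b(i), so its length is the number of boxes of
   [bet] outside b(i). *)
have len_chain i : (\sum_(j < size lam) minn (nth 0 lam j) i +
    \sum_(j < n) b i j = \sum_(j < n) nth 0 bet j)%N.
  pose c := mkseq (b i) n; have size_c : (size c <= n)%N by rewrite size_mkseq.
  have [chi chi_coord] := partition_coordinates p size_c.
  have LamE x : Lam i x <-> lattice p (nth 0%N c) (x *m Phi i).
    by split=> xL j; have := xL j; rewrite nth_mkseq.
  have [h [h_surj h_ker]] := quotient _ _ _ _ chi_coord LamE.
  have := length_ker_image unit_or_multiple h finB.
  have -> : [set: _] `&` [set y | h y = 0] = A `&` [set y | p ^+ i *: y = 0].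
    rewrite socleE; apply/seteqP; split.
      move=> y [_ /= hy]; have [x xE] := phiB_surj y.
      by exists x => //; apply/h_ker; rewrite xE.
    by move=> _ [x xL <-]; split=> //; apply/h_ker.
  have -> : h @` [set: _] = [set: _].
    by apply/seteqP; split=> // m _; have [y <-] := h_surj m; exists y.
  rewrite len_socle (lengthE unit_or_multiple lenB).
  rewrite (lengthE unit_or_multiple (has_length_module p_neq0 p_nonunit chi_coord)).
  move=> ->; congr (_ + _)%N; apply: eq_bigr => j _.
  by rewrite nth_mkseq.
have lamE : lam = alp.
  (* From [i] to [i.+1] the socle length grows by row [i.+1] of [lam] on one side, and by the number
     of entries [i.+1] of the tableau on the other. *)
  apply: is_partition_inj => // i; rewrite -(has_label_content T_tab).
  have E : (\sum_(j < n) b i j = \sum_(j < n) b i.+1 j + \sum_(j < n) J i j)%N.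
    by rewrite -big_split; apply: eq_bigr => j _; rewrite bS.
  have := len_chain i; have := len_chain i.+1; rewrite sum_nth_minn E.
  rewrite -/n /J; lia.
rewrite lamE in psi psi_range psi_ker.
have [phiA [phiA_surj phiA_ker]] := partition_coordinates p (leqnn (size alp)).
have [//||f fE] := @factor_linear _ _ _ _ phiA psi.
  by move=> x /phiA_ker /psi_ker.
exists (partition_module p alp), (partition_module p bet).
exists (partition_module p gam), f, g.
split; try exact: partition_module_type; split=> //.
  move=> y z E; apply/subr0_eq; have : f (y - z) = 0 by rewrite linearB /= E subrr.
  have [x <-] := phiA_surj (y - z); rewrite fE => /psi_ker xL.
  exact/phiA_ker.
move=> y; split=> [gy|[a <-]].
  have : A y by []; rewrite -psi_range => -[x _ <-].
  by exists (phiA x).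
have [x <-] := phiA_surj a; rewrite fE.
by have : range psi (psi x) by [exists x]; rewrite psi_range.
Qed.

End Sufficiency.

Theorem theorem3p2 (R : idomainType) (p : R) (alp bet gam : seq nat)
    (R_dvr : is_dvr R) (p_gen : maximal_ideal (principal_ideal p))
    (alp_part : is_partition alp) (bet_part : is_partition bet)
    (gam_part : is_partition gam) :
  (exists (A B C : lmodType R) (f : {linear A -> B}) (g : {linear B -> C}),
     [/\ short_exact f g, has_partition_type p A alp,
         has_partition_type p B bet & has_partition_type p C gam])
  <-> (exists T : nat -> nat -> nat, socle_tableau alp bet gam T).
Proof.
have unit_or_multiple := dvr_unit_or_multiple R_dvr p_gen.
have p_neq0 := dvr_generator_neq0 R_dvr p_gen.
have p_nonunit := maximal_generator_nonunit p_gen.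
split=> [[A [B [C [f [g [fg_exact typeA typeB typeC]]]]]]|[T T_tab]].
  have [phiA coordA] := partition_type_coordinates typeA.
  have [phiB coordB] := partition_type_coordinates typeB.
  have [phiC coordC] := partition_type_coordinates typeC.
  exact: (exact_tableau unit_or_multiple p_neq0 p_nonunit bet_part gam_part
    fg_exact coordA coordB coordC).
exact: (tableau_exact unit_or_multiple p_neq0 p_nonunit alp_part bet_part
  gam_part T_tab).
Qed.
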